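(* Let $\gamma\in(0,1]$ be a constant, and let $A$ be an $n\times n$ 0-1 matrix all of whose row and column sums equal $\Delta = \gamma n$. For $0<\sigma<1$ and $\delta>0$, the permanent estimator described in the context, run with a suitable number $t=t(n,\gamma,\sigma,\delta)$ of independent passes, outputs a $1+\sigma$ approximation of $\operatorname{per}(A)$, that is, a number $Z$ with $(1+\sigma)^{-1}\operatorname{per}(A)\le Z\le (1+\sigma)\operatorname{per}(A)$, with probability at least $1-\delta$, and its expected running time is $$O\left(n^{1.5+.5/\gamma}\,\frac{\log(1/\delta)}{\sigma^2}\right).$$
   Context: The permanent of an $n\times n$ matrix $A$ is $\operatorname{per}(A)=\sum_{\pi\in S_n}\prod_{i=1}^n A(i,\pi(i))$; for a 0-1 matrix it equals the number of perfect matchings of the bipartite graph with biadjacency matrix $A$. Define $g$ on nonnegative integers by $g(0):=0$, $g(1):=e$, and $g(a+1) := g(a) + 1 + \frac{1}{2g(a)} + \frac{0.6}{g(a)^2}$ for $a\ge 1$. For an $n\times n$ 0-1 matrix $A$ with row sums $r(1),\dots,r(n)$ let $\tilde M(A) := \prod_{i=1}^n \frac{g(r(i))}{e}$. For indices $i,j$ with $A(i,j)=1$, let $f(A,i,j)$ be the matrix obtained from $A$ by setting all entries of row $i$ and of column $j$ to $0$, except the entry in position $(i,j)$, which remains $1$. Pass of the algorithm on input $A$: set ACCEPT to TRUE and $\tilde A := A$. For $j=1,\dots,n$: let $\tilde r(i)$ be the row sums of $\tilde A$. If $\tilde r(i)=0$ for some $i$, or there exist $i\ne i'$ with $\tilde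 A(i,j)=\tilde A(i',j)=\tilde r(i)=\tilde r(i')=1$, set ACCEPT to FALSE. Otherwise choose $R\in\{1,\dots,n+1\}$ at random with $P(R=i) = \tilde M(f(\tilde A,i,j))/\tilde M(\tilde A)$ if $1\le i\le n$ and $\tilde A(i,j)=1$, $P(R=i)=0$ if $1\le i\le n$ and $\tilde A(i,j)=0$, and $P(R=n+1)=1-\sum_{i=1}^n P(R=i)$; if $R\le n$, set $\pi(j):=R$ and replace $\tilde A$ by $f(\tilde A,R,j)$; if $R=n+1$, set ACCEPT to FALSE. The pass accepts if ACCEPT is TRUE at its end. Permanent estimator: run $t$ independent passes on $A$, let $N$ be the number of accepting passes, and output $Z:=\tilde M(A)\cdot N/t$. Running time counts elementary operations, where arithmetic operations on the numbers involved have unit cost and choosing $R$ from a given distribution on $\{1,\dots,n+1\}$ takes $O(n)$ time. The constant implied by $O(\cdot)$ may depend on $\gamma$ but is uniform over $n$, $0<\sigma<1$ and $0<\delta\le 1/2$. *)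

(* Defs.v *)
From mathcomp Require Import all_boot all_order all_algebra all_fingroup.
From mathcomp Require Import all_classical all_reals all_analysis.

Set Implicit Arguments.
Unset Strict Implicit.
Unset Printing Implicit Defensive.

Import Order.TTheory GRing.Theory Num.Theory.
Local Open Scope ring_scope.

(* Randomized computations with a running time.  [Tick k] spends [k] elementary
   operations.  [Choose w] draws an outcome in {1, ..., m + 1} with weights [w];
   [Some i] is one of the first m outcomes and [None] is the outcome m + 1.
   Nothing forces [w] to be a probability distribution: this is what
   [well_posed] asserts. *)
Inductive comp (R T : Type) : Type :=
| Ret of T
| Tick of nat & comp R T
| Choose (m : nat) of (option 'I_m -> R) & (option 'I_m -> comp R T).

Arguments Ret {R T} _.
Arguments Tick {R T} _ _.
Arguments Choose {R T m} _ _.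

Fixpoint bind (R T U : Type) (c : comp R T) (k : T -> comp R U) : comp R U :=
  match c with
  | Ret x => k x
  | Tick n c' => Tick n (bind c' k)
  | Choose m w c' => Choose w (fun o => bind (c' o) k)
  end.

Declare Scope comp_scope.
Delimit Scope comp_scope with comp.

Notation "'let*' x ':=' c 'in' k" := (bind c (fun x => k))
  (at level 200, x name, c at level 200, k at level 200,
   format "'[v' 'let*'  x  ':='  c  'in' '//' k ']'") : comp_scope.
Notation "'let*' ' p ':=' c 'in' k" := (bind c (fun x => let p := x in k))
  (at level 200, p strict pattern, c at level 200, k at level 200,
   format "'[v' 'let*'  ' p  ':='  c  'in' '//' k ']'") : comp_scope.

Local Open Scope comp_scope.

Fixpoint foldM (R I S : Type) (xs : seq I) (body : I -> S -> comp R S) (s : S)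
  : comp R S :=
  if xs is x :: xs' then let* s' := body x s in foldM xs' body s' else Ret s.

Section Semantics.
Variables (R : realType) (T : Type).

Fixpoint expect (c : comp R T) (h : T -> R) : R :=
  match c with
  | Ret x => h x
  | Tick _ c' => expect c' h
  | Choose m w c' => \sum_(o : option 'I_m) w o * expect (c' o) h
  end.

Definition prob (c : comp R T) (E : pred T) : R :=
  expect c (fun x => (E x)%:R).

(* Drawing from a given distribution on {1, ..., m + 1} takes time m + 1. *)
Fixpoint expected_time (c : comp R T) : R :=
  match c with
  | Ret _ => 0
  | Tick n c' => n%:R + expected_time c'
  | Choose m w c' =>
      m.+1%:R + \sum_(o : option 'I_m) w o * expected_time (c' o)
  end.

(* Every draw that is reached with nonzero probability uses a genuine
   probability distribution. *)
Fixpoint well_posed (c : comp R T) : Prop :=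
  match c with
  | Ret _ => True
  | Tick _ c' => well_posed c'
  | Choose m w c' =>
      [/\ forall o, 0 <= w o, \sum_(o : option 'I_m) w o = 1
        & forall o, w o != 0 -> well_posed (c' o)]
  end.

Definition same_law (c d : comp R T) : Prop :=
  forall h : T -> R, expect c h = expect d h.

End Semantics.

Definition per (R : pzSemiRingType) (n : nat) (A : 'M[R]_n) : R :=
  \sum_(s : 'S_n) \prod_(i < n) A i (s i).

(* A 0-1 matrix is a matrix of booleans; this is the same matrix over [R]. *)
Definition zero_one_mx (R : pzSemiRingType) (n : nat) (A : 'M[bool]_n) : 'M[R]_n :=
  map_mx (fun b : bool => b%:R) A.

Definition row_sum (n : nat) (A : 'M[bool]_n) (i : 'I_n) : nat :=
  (\sum_(j < n) A i j)%N.

Definition col_sum (n : nat) (A : 'M[bool]_n) (j : 'I_n) : nat :=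
  (\sum_(i < n) A i j)%N.

Definition approximates (R : realType) (sigma p z : R) : bool :=
  ((1 + sigma)^-1 * p <= z) && (z <= (1 + sigma) * p).

Section Estimator.
Variable R : realType.

Fixpoint g (a : nat) : R :=
  match a with
  | 0 => 0
  | a'.+1 =>
      if a' is 0%N then expR 1
      else g a' + 1 + 1 / (2 * g a') + (6 / 10) / g a' ^+ 2
  end.

Variable n : nat.
Implicit Type A : 'M[bool]_n.

Definition Mtilde A : R := \prod_(i < n) (g (row_sum A i) / expR 1).

Definition fix_entry A (i j : 'I_n) : 'M[bool]_n :=
  \matrix_(k, l) if (k == i) && (l == j) then A k l
                 else if (k == i) || (l == j) then false else A k l.

Definition blocked A (j : 'I_n) : bool :=
  [exists i, row_sum A i == 0%N] ||
  [exists i, exists i', [&& i != i', A i j, A i' j,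
                            row_sum A i == 1%N & row_sum A i' == 1%N]].

Definition row_weight A (j i : 'I_n) : R :=
  if A i j then Mtilde (fix_entry A i j) / Mtilde A else 0.

Definition weight A (j : 'I_n) (o : option 'I_n) : R :=
  if o is Some i then row_weight A j i else 1 - \sum_(i < n) row_weight A j i.

Definition array (V : Type) := {ffun 'I_n -> V}.

Definition upd (V : Type) (a : array V) (i : 'I_n) (x : V) : array V :=
  [ffun k => if k == i then x else a k].

(* ACCEPT, the current matrix, and the values of pi assigned so far. *)
Definition pass_state := (bool * 'M[bool]_n * array (option 'I_n))%type.

Definition pass_step (j : 'I_n) (st : pass_state) : comp R pass_state :=
  let: (accept, A, pi) := st in
  if blocked A j then Ret (false, A, pi)
  else Choose (weight A j) (fun o =>
    if o is Some i then Ret (accept, fix_entry A i j, upd pi j (Some i))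
    else Ret (false, A, pi)).

Definition pass A : comp R (bool * array (option 'I_n)) :=
  let* '(accept, _, pi) :=
    foldM (enum 'I_n) pass_step (true, A, [ffun=> None]) in
  Ret (accept, pi).

Definition estimator A (t : nat) : comp R R :=
  let* N := foldM (iota 0%N t) (fun _ N =>
    let* '(accept, _) := pass A in
    Ret (N + accept)%N) 0%N in
  Ret (Mtilde A * N%:R / t%:R).

(* The same algorithm as a random access program, whose running time is
   counted.  Each [op] is one elementary operation: an arithmetic operation, a
   comparison, a boolean connective, or one array access; a loop iteration costs
   one more, and creating or copying an array costs its size.  Everything outside [op] only moves data,
   and arrays are used as mutable memory, i.e. the old value of an updated
   array is never used again.  The row sums are maintained along with the
   matrix, the values of [g] are tabulated, and the ratios
   [Mtilde (fix_entry A i j) / Mtilde A], for all i, are obtained from prefix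
   and suffix products of the factors by which the rows change. *)
Definition op (T : Type) (x : T) : comp R T := Tick 1%N (Ret x).

Definition loop (I S : Type) (xs : seq I) (body : I -> S -> comp R S) (s : S)
  : comp R S := foldM xs (fun x s => Tick 1%N (body x s)) s.

Definition new_array (V : Type) (x : V) : comp R (array V) :=
  Tick n (Ret [ffun=> x]).

Definition copy_mx A : comp R 'M[bool]_n := Tick (n * n)%N (Ret A).

Definition clear_entry A (i j : 'I_n) : 'M[bool]_n :=
  \matrix_(k, l) if (k == i) && (l == j) then false else A k l.

Definition table := nat -> R.

Definition upd_table (tab : table) (a : nat) (x : R) : table :=
  fun b => if b == a then x else tab b.

Definition g_table : comp R table :=
  let* tab := op (upd_table (fun=> 0) 0%N 0) in
  let* tab := op (upd_table tab 1%N (expR 1)) in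
  loop (iota 1%N n.-1) (fun a tab =>
    let* x := op (tab a) in
    let* y := op (x + 1) in
    let* u := op (2 * x) in
    let* u := op (1 / u) in
    let* y := op (y + u) in
    let* v := op (x ^+ 2) in
    let* v := op ((6 / 10) / v) in
    let* y := op (y + v) in
    let* b := op a.+1 in
    op (upd_table tab b y)) tab.

Definition row_sums_prog A : comp R (array nat) :=
  let* r := new_array 0%N in
  loop (enum 'I_n) (fun i r =>
    let* s := loop (enum 'I_n) (fun j s =>
      let* b := op (A i j) in
      op (s + b)%N) 0%N in
    op (upd r i s)) r.

Definition blocked_prog A (r : array nat) (j : 'I_n) : comp R bool :=
  let* '(zero, ones) := loop (enum 'I_n) (fun i acc =>
    let: (zero, ones) := acc in
    let* s := op (r i) in
    let* b := op (s == 0%N) in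
    let* zero := op (zero || b) in
    let* b := op (s == 1%N) in
    let* aij := op (A i j) in
    let* b := op (b && aij) in
    let* ones := op (ones + b)%N in
    Ret (zero, ones)) (false, 0%N) in
  let* b := op (1 < ones)%N in
  op (zero || b).

(* The weights of the rows, and the weight of the remaining outcome. *)
Definition weights_prog (tab : table) A (r : array nat) (j : 'I_n)
  : comp R (array R * R) :=
  let* q := new_array 1 in
  let* q := loop (enum 'I_n) (fun i q =>
    let* aij := op (A i j) in
    if aij then
      let* s := op (r i) in
      let* y := op (tab s) in
      let* s := op s.-1 in
      let* x := op (tab s) in
      let* x := op (x / y) in
      op (upd q i x)
    else Ret q) q in
  let* pre := new_array 1 in
  let* '(pre, _) := loop (enum 'I_n) (fun i acc =>
    let: (pre, p) := acc in
    let* pre := op (upd pre i p) in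
    let* x := op (q i) in
    let* p := op (p * x) in
    Ret (pre, p)) (pre, 1) in
  let* w := new_array 0 in
  let* '(w, _, total) := loop (rev (enum 'I_n)) (fun i acc =>
    let: (w, suf, total) := acc in
    let* aij := op (A i j) in
    let* '(w, total) :=
      if aij then
        let* x := op (tab 1%N) in
        let* s := op (r i) in
        let* y := op (tab s) in
        let* x := op (x / y) in
        let* y := op (pre i) in
        let* x := op (x * y) in
        let* x := op (x * suf) in
        let* w := op (upd w i x) in
        let* total := op (total + x) in
        Ret (w, total)
      else Ret (w, total) in
    let* x := op (q i) in
    let* suf := op (suf * x) in
    Ret (w, suf, total)) (w, 1, 0) in
  let* rest := op (1 - total) in
  Ret (w, rest).

Definition fix_entry_prog A (r : array nat) (i j : 'I_n)
  : comp R ('M[bool]_n * array nat) :=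
  let* '(A, r) := loop (enum 'I_n) (fun k (acc : 'M[bool]_n * array nat) =>
    let: (A, r) := acc in
    let* e := op (k == i) in
    if e then Ret (A, r) else
    let* akj := op (A k j) in
    if akj then
      let* A := op (clear_entry A k j) in
      let* s := op (r k) in
      let* s := op s.-1 in
      let* r := op (upd r k s) in
      Ret (A, r)
    else Ret (A, r)) (A, r) in
  let* A := loop (enum 'I_n) (fun l (A : 'M[bool]_n) =>
    let* e := op (l == j) in
    if e then Ret A else op (clear_entry A i l)) A in
  let* r := op (upd r i 1%N) in
  Ret (A, r).

Definition prog_state :=
  (bool * 'M[bool]_n * array nat * array (option 'I_n))%type.

Definition pass_step_prog (tab : table) (j : 'I_n) (st : prog_state)
  : comp R prog_state :=
  let: (accept, A, r, pi) := st in
  let* b := blocked_prog A r j in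
  if b then
    let* accept := op false in
    Ret (accept, A, r, pi)
  else
    let* '(w, rest) := weights_prog tab A r j in
    Choose (fun o => if o is Some i then w i else rest) (fun o =>
      if o is Some i then
        let* pi := op (upd pi j (Some i)) in
        let* '(A, r) := fix_entry_prog A r i j in
        Ret (accept, A, r, pi)
      else
        let* accept := op false in
        Ret (accept, A, r, pi)).

Definition pass_prog (tab : table) A : comp R (bool * array (option 'I_n)) :=
  let* B := copy_mx A in
  let* r := row_sums_prog B in
  let* pi := new_array None in
  let* '(accept, _, _, pi) :=
    loop (enum 'I_n) (pass_step_prog tab) (true, B, r, pi) in
  Ret (accept, pi).

Definition estimator_prog A (t : nat) : comp R R :=
  let* tab := g_table in
  let* N := loop (iota 0%N t) (fun _ N =>
    let* '(accept, _) := pass_prog tab A in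
    op (N + accept)%N) 0%N in
  let* r := row_sums_prog A in
  let* M := loop (enum 'I_n) (fun i M =>
    let* s := op (r i) in
    let* x := op (tab s) in
    let* x := op (x / expR 1) in
    op (M * x)) 1 in
  let* z := op (M * N%:R) in
  op (z / t%:R).

End Estimator.

(* Main.v *)
Require Import Defs.
From mathcomp Require Import all_boot all_order all_algebra all_fingroup.
From mathcomp Require Import all_classical all_reals all_analysis.
From mathcomp Require Import fintype finset complex polyrcf ring lra zify.

(* The pass is a sequential importance sampler: expanding the permanent along
   the current column and cancelling the ratios of [Mtilde] shows that it accepts
   with probability exactly [per A / Mtilde A].  The ratios sum to at most 1
   because [g (a + 1) / g a >= exp (1 / g a)] and [exp s >= e * s].  A Chernoff
   bound then reduces everything to bounding [Mtilde A / per A].  Above,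
   [g a <= a + ln a / 2 + e]; below, the van der Waerden bound
   [per A >= n! (Delta / n)^n] together with Stirling's formula, which gives
   [Mtilde A / per A = O(n^(1/(2 gamma) - 1/2))], while a pass takes time O(n^2).

   The van der Waerden bound is proved by Gurvits' capacity method: the product
   of the linear forms given by the rows is differentiated with respect to one
   variable after the other; nonvanishing on the right half-plane makes each
   univariate restriction real-rooted, so that by AM-GM the capacity drops by at
   most the factor [((m - 1) / m)^(m - 1)] at each step. *)

Import Defs.

Set Implicit Arguments.
Unset Strict Implicit.
Unset Printing Implicit Defensive.

Import Order.TTheory GRing.Theory Num.Theory.
Import numFieldNormedType.Exports.
Local Open Scope ring_scope.

(** * Simulation of computations *)

(** The exponent of the running time arises as follows. Since [n / Delta = 1 / gamma], raising the
    upper bound on [g Delta] to the power [n] costs a factor [exp (e / gamma) n^(1/(2 gamma))] over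
    [Delta^n]. Stirling's formula gains [n^(1/2)] over [(n / e)^n], and this [e^n] cancels against
    the denominators of [Mtilde]. The [n^2] of a pass then turns [1/(2 gamma) - 1/2] into
    [3/2 + 1/(2 gamma)]. In the capacity argument no multivariate polynomial appears. Coefficients
    are sums over functions choosing one variable from each row, and only the restrictions to a
    single variable are polynomials. Locating their roots calls for an algebraically closed field,
    so the matrix is moved to [R[i]]. *)

(* [simulates rel c d k]: up to ticks, [c] makes the same draws as [d], equal
   draws lead to [rel]-related results, and every run of [c] lasts at most [k].
   Draws of weight 0 are exempt: there the row sums kept by the program are not
   those of its matrix. *)
Inductive simulates (R : realType) (T U : Type) (rel : T -> U -> Prop) :
  comp R T -> comp R U -> nat -> Prop :=
| SimRet x y k : rel x y -> simulates rel (Ret x) (Ret y) k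
| SimTick a c d k : simulates rel c d k -> simulates rel (Tick a c) d (a + k)
| SimChoose m (w w' : option 'I_m -> R) c d k :
    w =1 w' -> (forall o, w' o != 0 -> simulates rel (c o) (d o) k) ->
    simulates rel (Choose w c) (Choose w' d) (m.+1 + k).

(* A program without draws simulates the trivial computation. *)
Notation runs c Q k := (simulates (fun x (_ : unit) => Q x) c (Ret tt) k).

Section CompTheory.
Variable R : realType.

Lemma expect_bind (T U : Type) (c : comp R T) (k : T -> comp R U) (h : U -> R) :
  expect (bind c k) h = expect c (fun x => expect (k x) h).
Proof. by elim: c => //= m w c IHc; apply: eq_bigr => o _; rewrite IHc. Qed.

Lemma bindR (T : Type) (c : comp R T) : bind c (fun x => Ret x) = c.
Proof.
elim: c => //= [a c -> //|m w c IHc]; congr (Choose _ _).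
by apply/funext.
Qed.

Lemma eq_expect (T : Type) (c : comp R T) (h h' : T -> R) :
  h =1 h' -> expect c h = expect c h'.
Proof.
by move=> hh'; elim: c => //= m w c IHc; apply: eq_bigr => o _; rewrite IHc.
Qed.

Lemma well_posed_bind (T U : Type) (c : comp R T) (k : T -> comp R U) :
  well_posed c -> (forall x, well_posed (k x)) -> well_posed (bind c k).
Proof.
move=> wc wk; elim: c wc => //= m w c IHc [w_ge0 sum_w wc].
by split=> // o /wc; apply: IHc.
Qed.

Lemma well_posed_foldM (I S : Type) (xs : seq I) (body : I -> S -> comp R S) s :
  (forall x s, well_posed (body x s)) -> well_posed (foldM xs body s).
Proof.
by move=> wb; elim: xs s => //= x xs IHxs s; apply: well_posed_bind.
Qed.

Lemma expect_linear (T : Type) (c : comp R T) a (h h' : T -> R) :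
  expect c (fun x => a * h x + h' x) = a * expect c h + expect c h'.
Proof.
elim: c => //= m w c IHc; rewrite mulr_sumr -big_split; apply: eq_bigr => o _ /=.
by rewrite IHc mulrDr mulrCA.
Qed.

Lemma expect_const (T : Type) (c : comp R T) a :
  well_posed c -> expect c (fun=> a) = a.
Proof.
elim: c => //= m w c IHc [_ sum_w wc]; rewrite -[RHS]mul1r -sum_w mulr_suml.
apply: eq_bigr => o _; have [->|/wc/IHc -> //] := eqVneq (w o) 0.
by rewrite !mul0r.
Qed.

Lemma le_expect (T : Type) (c : comp R T) (h h' : T -> R) :
  well_posed c -> (forall x, h x <= h' x) -> expect c h <= expect c h'.
Proof.
move=> + le_h; elim: c => //= m w c IHc [w_ge0 _ wc].
apply: ler_sum => o _; have [->|/wc/IHc le_c] := eqVneq (w o) 0.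
  by rewrite !mul0r.
by rewrite ler_wpM2l.
Qed.

Lemma simulates_le (T U : Type) (rel : T -> U -> Prop) (c : comp R T)
    (d : comp R U) k k' :
  (k <= k')%N -> simulates rel c d k -> simulates rel c d k'.
Proof.
move=> + sim_c; elim: sim_c k' => {c d k}.
- by move=> x y k rel_xy k' _; constructor.
- move=> a c d k _ IHc k' le_k.
  have -> : k' = (a + (k' - a))%N by lia.
  by constructor; apply: IHc; lia.
- move=> m w w' c d k ww' _ IHc k' le_k.
  have -> : k' = (m.+1 + (k' - m.+1))%N by lia.
  by constructor=> // o wo; apply: IHc => //; lia.
Qed.

Lemma simulates_bind (T U T' U' : Type) (rel : T -> U -> Prop)
    (rel' : T' -> U' -> Prop) (c : comp R T) d k f f' k' :
  simulates rel c d k ->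
  (forall x y, rel x y -> simulates rel' (f x) (f' y) k') ->
  simulates rel' (bind c f) (bind d f') (k + k').
Proof.
move=> sim_c sim_f; elim: sim_c => {c d k} /=.
- by move=> x y k /sim_f; apply: simulates_le; rewrite leq_addl.
- by move=> a c d k _ IHc; rewrite -addnA; constructor.
- by move=> m w w' c d k ww' _ IHc; rewrite -addnA; constructor.
Qed.

Lemma simulates_foldM (I S S' : Type) (rel : S -> S' -> Prop) (xs : seq I)
    (body : I -> S -> comp R S) (body' : I -> S' -> comp R S') k s s' :
  (forall x s s', rel s s' -> simulates rel (body x s) (body' x s') k) ->
  rel s s' ->
  simulates rel (foldM xs body s) (foldM xs body' s') (size xs * k).
Proof.
move=> sim_b; elim: xs s s' => [|x xs IHxs] s s' rel_s; first by constructor.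
by rewrite mulSn; apply: simulates_bind (sim_b _ _ _ rel_s) _.
Qed.

Lemma simulates_loop (I S S' : Type) (rel : S -> S' -> Prop) (xs : seq I)
    (body : I -> S -> comp R S) (body' : I -> S' -> comp R S') k s s' :
  (forall x s s', rel s s' -> simulates rel (body x s) (body' x s') k) ->
  rel s s' ->
  simulates rel (loop xs body s) (foldM xs body' s') (size xs * k.+1).
Proof.
move=> sim_b; apply: simulates_foldM => x t t' rel_t.
by rewrite -add1n; constructor; apply: sim_b.
Qed.

Lemma simulates_expect (T U : Type) (rel : T -> U -> Prop) (c : comp R T)
    (d : comp R U) k h h' :
  simulates rel c d k -> (forall x y, rel x y -> h x = h' y) ->
  expect c h = expect d h'.
Proof.
move=> sim_c hh'; elim: sim_c => {c d k} //=.
  by move=> x y k; apply: hh'.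
move=> m w w' c d k ww' _ IHc; apply: eq_bigr => o _; rewrite ww'.
by have [->|/IHc -> //] := eqVneq (w' o) 0; rewrite !mul0r.
Qed.

Lemma simulates_well_posed (T U : Type) (rel : T -> U -> Prop) (c : comp R T)
    (d : comp R U) k :
  simulates rel c d k -> well_posed d -> well_posed c.
Proof.
elim=> {c d k} //= m w w' c d k ww' _ IHc [w_ge0 sum_w wd]; split=> [i| |i].
- by rewrite ww'.
- by rewrite (eq_bigr w').
- by rewrite ww' => wi; apply: IHc wi (wd _ wi).
Qed.

Lemma simulates_expected_time (T U : Type) (rel : T -> U -> Prop) (c : comp R T)
    (d : comp R U) k :
  simulates rel c d k -> well_posed d -> expected_time c <= k%:R.
Proof.
elim=> {c d k} /=.
- by move=> *; apply: ler0n.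
- by move=> a c d k _ IHc wd; rewrite natrD lerD2l; apply: IHc.
move=> m w w' c d k ww' _ IHc [w_ge0 sum_w wd]; rewrite natrD lerD2l.
have -> : k%:R = \sum_o w' o * k%:R by rewrite -mulr_suml sum_w mul1r.
apply: ler_sum => o _; rewrite ww'.
have [->|wo] := eqVneq (w' o) 0; first by rewrite !mul0r.
by apply: ler_wpM2l => //; apply: IHc wo (wd _ wo).
Qed.

Lemma simulates_op (T U : Type) (rel : T -> U -> Prop) (c : comp R T)
    (d : comp R U) k :
  simulates rel c d k -> simulates rel (Tick 1 c) d k.+1.
Proof. by rewrite -add1n; constructor. Qed.

Lemma runs_bind (T T' U : Type) (Q : T -> Prop) (rel : T' -> U -> Prop)
    (c : comp R T) (f : T -> comp R T') d k k' :
  runs c Q k -> (forall x, Q x -> simulates rel (f x) d k') ->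
  simulates rel (bind c f) d (k + k').
Proof.
move=> run_c sim_f.
(* [bind (Ret tt) (fun=> d)] computes to [d], so a prefix without draws leaves the abstract side
   untouched. *)
by apply: (simulates_bind (f' := fun=> d) run_c) => x _; apply: sim_f.
Qed.

(** The invariant speaks of the prefix treated so far. The splitting of [xs] is passed on because,
    for a duplicate-free [xs], it shows that the current element is new. *)
Lemma runs_loop (I : eqType) (S : Type) (Inv : seq I -> S -> Prop) (xs : seq I)
    (body : I -> S -> comp R S) k s :
  (forall xs1 x xs2 s, xs = xs1 ++ x :: xs2 -> Inv xs1 s ->
     runs (body x s) (Inv (rcons xs1 x)) k) ->
  Inv [::] s -> runs (loop xs body s) (Inv xs) (size xs * k.+1).
Proof.
move=> run_b Inv0.
suff run_xs xs1 xs2 t : xs = xs1 ++ xs2 -> Inv xs1 t ->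
    runs (loop xs2 body t) (Inv xs) (size xs2 * k.+1) by apply: run_xs Inv0.
elim: xs2 xs1 t => [|x xs2 IHxs] xs1 t def_xs Inv_t.
  by rewrite cats0 in def_xs; apply: SimRet; rewrite def_xs; exact: Inv_t.
rewrite [size _]/= mulSn; apply: (@runs_bind _ _ _ (Inv (rcons xs1 x))).
  by apply: simulates_op; apply: run_b def_xs Inv_t.
by move=> t' Inv_t'; apply: IHxs Inv_t'; rewrite cat_rcons.
Qed.

Lemma runs_weaken (T : Type) (c : comp R T) (Q Q' : T -> Prop) k k' :
  runs c Q k -> (forall x, Q x -> Q' x) -> (k <= k')%N -> runs c Q' k'.
Proof.
move=> run_c QQ' le_k; apply: simulates_le le_k _.
rewrite -(addn0 k) -(bindR c); apply: runs_bind run_c _ => x /QQ'; exact: SimRet.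
Qed.

End CompTheory.

(** * The weights *)

Section G.
Variable R : realType.
Local Notation g := (@g R).
Local Notation e := (@expR R 1).

Lemma expR1_ge2 : 2 <= e.
Proof. by exact: expR_ge1Dx. Qed.

Lemma gS a : (0 < a)%N -> g a.+1 = g a + 1 + 1 / (2 * g a) + (6 / 10) / g a ^+ 2.
Proof. by case: a. Qed.

Lemma g_ge a : (0 < a)%N -> a.+1%:R <= g a.
Proof.
case: a => // a _; elim: a => [|a IHa]; first exact: expR1_ge2.
have g_gt0 : 0 < g a.+1 by apply: lt_le_trans IHa; rewrite ltr0n.
rewrite gS // -natr1; apply: (@le_trans _ _ (g a.+1 + 1)); first by rewrite lerD2r.
rewrite -[leRHS]addrA lerDl addr_ge0 // divr_ge0 //.
  by rewrite mulr_ge0 // ltW.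
by rewrite exprn_ge0 // ltW.
Qed.

Lemma g_gt0 a : (0 < a)%N -> 0 < g a.
Proof. by move=> /g_ge; apply: lt_le_trans; rewrite ltr0n. Qed.

Lemma g_ge0 a : 0 <= g a.
Proof. by case: a => // a; rewrite ltW // g_gt0. Qed.

Lemma nneg_derive_le (f df : R -> R) (a b : R) : a <= b ->
  (forall x : R, is_derive x 1 f (df x)) -> (forall x, a <= x <= b -> 0 <= df x) ->
  f a <= f b.
Proof.
move=> le_ab f_df df_ge0.
have [|c c_in def_f] := MVT_segment le_ab (fun x _ => f_df x).
  by apply: derivable_within_continuous => y _; apply: ex_derive.
by rewrite -subr_ge0 def_f mulr_ge0 ?subr_ge0 // df_ge0 // -in_itv.
Qed.

(* The cubic coefficient 0.6 leaves room for the tail of the exponential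
   series, as [y <= 1 / e] below. *)
Lemma expR_le_cubic (y : R) : 0 <= y <= 1 ->
  expR y <= 1 + y + y ^+ 2 / 2 + (6 / 10) * y ^+ 3.
Proof.
move=> /andP[y_ge0 y_le].
(* For the cubic P, the derivative of [P * expR (- x)] is [(P' - P) * expR (- x)]; in [P' - P] the
   terms of degree 0 and 1 cancel. *)
pose f x : R := (1 + x + x ^+ 2 / 2 + (6 / 10) * x ^+ 3) * expR (- x).
pose df x : R := (13 / 10 * x ^+ 2 - 6 / 10 * x ^+ 3) * expR (- x).
have f_df (x : R) : is_derive x 1 f (df x).
  apply: is_derive_eq.
  by rewrite /df /GRing.scale /=; field.
have : f 0 <= f y.
  apply: (nneg_derive_le y_ge0 f_df) => x /andP[x_ge0 x_le].
  by rewrite mulr_ge0 ?expR_ge0 //; nra.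
rewrite /f oppr0 expR0 expRN !expr0n /= !mulr1 !mul0r !mulr0 !addr0.
by rewrite ler_pdivlMr ?expR_gt0 // mul1r.
Qed.

(** This explains the recursion of [g]: with [y = 1 / g a.-1], the ratio is exactly the cubic
    [1 + y + y^2 / 2 + 0.6 y^3]. *)
Lemma g_ratio_ge a : (1 < a)%N -> expR (1 / g a.-1) <= g a / g a.-1.
Proof.
case: a => // a a_gt0; have a1 : (0 < a)%N by [].
rewrite gS //=; have g_a := g_ge a1; have ga_gt0 := g_gt0 a1.
have g_ge1 : 1 <= g a by apply: le_trans g_a; rewrite ler1n.
have -> : (g a + 1 + 1 / (2 * g a) + 6 / 10 / g a ^+ 2) / g a =
    1 + 1 / g a + (1 / g a) ^+ 2 / 2 + (6 / 10) * (1 / g a) ^+ 3.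
  by field; rewrite gt_eqF.
apply: expR_le_cubic; rewrite divr_ge0 ?(ltW ga_gt0) //=.
by rewrite ler_pdivrMr // mul1r.
Qed.

(** If no [r i] is 1, the sum equals [e * S] divided by the product of the ratios
    [g (r i) / g (r i).-1], where [S] is the sum of the [1 / g (r i).-1]. That product is at least
    [expR S], and [expR S >= e * S]. *)
Lemma sum_le_prod_g (I : finType) (P : pred I) (r : I -> nat) :
  (forall i, P i -> (0 < r i)%N) ->
  {in P &, forall i i', i != i' -> ~~ ((r i == 1%N) && (r i' == 1%N))} ->
  \sum_(i | P i) (e / g (r i)) * \prod_(k | P k && (k != i)) (g (r k).-1 / g (r k))
    <= 1.
Proof.
move=> r_gt0 r_one.
have r_ne0 i : P i -> g (r i) != 0 by move=> /r_gt0/g_gt0/lt0r_neq0.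
have ratio_ge0 i : 0 <= g (r i).-1 / g (r i) by rewrite divr_ge0 ?g_ge0.
have [/existsP[i0 /andP[Pi0 /eqP ri0]]|no_one] := boolP [exists i, P i && (r i == 1%N)].
  (* The index with [r i0 = 1] is unique. All other terms contain the factor [g 0 / g 1 = 0], and
     its own term is [e / g 1 = 1] times ratios at most 1. *)
  rewrite (bigD1 i0) //= ri0 divff ?mul1r; last by rewrite gt_eqF ?expR_gt0.
  rewrite [X in _ + X]big1 ?addr0 => [|i /andP[Pi ii0]].
    apply: prodr_ile1 => k /andP[Pk ki0]; rewrite ratio_ge0.
    have rk1 : (1 < r k)%N.
      have := r_one k i0 Pk Pi0 ki0; rewrite ri0 andbT; have := r_gt0 k Pk; lia.
    rewrite ler_pdivrMr ?g_gt0 ?r_gt0 // mul1r.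
    have rk : (0 < (r k).-1)%N by lia.
    rewrite -[in leRHS](prednK (r_gt0 k Pk)) gS //.
    have := g_ge0 (r k).-1; rewrite -!addrA lerDl => g0.
    by rewrite !addr_ge0 // divr_ge0 // ?mulr_ge0 // exprn_ge0.
  by rewrite (bigD1 i0) /= ?ri0 ?mul0r ?mulr0 // Pi0 eq_sym.
have r_gt1 i : P i -> (1 < r i)%N.
  move=> Pi; have := r_gt0 i Pi; move: no_one; rewrite negb_exists => /forallP/(_ i).
  by rewrite Pi /=; lia.
have g1_gt0 i : P i -> 0 < g (r i).-1.
  by move=> /r_gt1 ri; apply: g_gt0; lia.
pose S := \sum_(i | P i) 1 / g (r i).-1.
have le_prod : expR S <= \prod_(i | P i) (g (r i) / g (r i).-1).
  rewrite expR_sum; apply: ler_prod => i Pi.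
  by rewrite expR_ge0 g_ratio_ge ?r_gt1.
have prod_gt0 : 0 < \prod_(i | P i) (g (r i) / g (r i).-1).
  by apply: prodr_gt0 => i Pi; rewrite divr_gt0 ?g1_gt0 ?g_gt0 ?r_gt0.
have -> : \sum_(i | P i) (e / g (r i)) *
      \prod_(k | P k && (k != i)) (g (r k).-1 / g (r k)) =
    (e * S) / \prod_(i | P i) (g (r i) / g (r i).-1).
  rewrite /S mulr_sumr mulr_suml; apply: eq_bigr => i Pi.
  rewrite -prodfV [in RHS](bigD1 i) //= mulrA; congr (_ * _).
    by field; rewrite r_ne0 // gt_eqF // g1_gt0.
  by apply: eq_bigr => k _; rewrite invf_div.
rewrite ler_pdivrMr // mul1r; apply: le_trans le_prod.
rewrite -[S in leRHS](subrK 1) expRD mulrC ler_pM2r ?expR_gt0 //.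
by have := expR_ge1Dx (S - 1); rewrite addrC subrK.
Qed.

End G.

(** * Acceptance probability of a pass *)

Section Pass.
Variables (R : realType) (n : nat).
Implicit Types (A : 'M[bool]_n) (i j k : 'I_n).
Local Notation g := (@g R).
Local Notation e := (@expR R 1).

Lemma row_sumD1 A i j : row_sum A i = (A i j + \sum_(l | l != j) A i l)%N.
Proof. by rewrite /row_sum (bigD1 j). Qed.

Lemma row_sum_fix_entry A i j k : A i j ->
  row_sum (fix_entry A i j) k =
  if k == i then 1%N else (row_sum A k - A k j)%N.
Proof.
move=> Aij; rewrite (row_sumD1 _ k j) (row_sumD1 A k j) mxE eqxx andbT orbT addKn.
have [->|ki] := eqVneq k i.
  by rewrite Aij big1 // => l /negPf lj; rewrite mxE eqxx lj.
by rewrite add0n; apply: eq_bigr => l /negPf lj; rewrite mxE lj (negPf ki).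
Qed.

Lemma unblocked_row_gt0 A j i : ~~ blocked A j -> (0 < row_sum A i)%N.
Proof.
rewrite negb_or => /andP[/existsPn/(_ i)]; rewrite -lt0n //.
Qed.

Lemma unblocked_row_eq1 A j i i' : ~~ blocked A j -> A i j -> A i' j -> i != i' ->
  ~~ ((row_sum A i == 1%N) && (row_sum A i' == 1%N)).
Proof.
rewrite negb_or => /andP[_ /existsPn/(_ i)/existsPn/(_ i')] + Ai Ai' ii'.
by rewrite ii' Ai Ai'.
Qed.

Lemma Mtilde_gt0 A : (forall i, (0 < row_sum A i)%N) -> 0 < Mtilde R A.
Proof.
by move=> rA; apply: prodr_gt0 => i _; rewrite divr_gt0 ?g_gt0 ?expR_gt0.
Qed.

(** Rows without an entry in column [j] cancel, row [i] ends with sum 1 and so contributes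
    [g 1 / e = 1] to the numerator, and every other row meeting column [j] loses one entry. *)
Lemma row_weightE A i j : ~~ blocked A j -> A i j ->
  row_weight R A j i = (e / g (row_sum A i)) *
    \prod_(k | A k j && (k != i)) (g (row_sum A k).-1 / g (row_sum A k)).
Proof.
move=> unb Aij; rewrite /row_weight Aij /Mtilde -prodf_div.
have e_neq0 : e != 0 by rewrite gt_eqF ?expR_gt0.
have g_neq0 k : g (row_sum A k) != 0.
  by rewrite lt0r_neq0 // g_gt0 // (unblocked_row_gt0 _ unb).
rewrite (bigD1 i) //= row_sum_fix_entry // eqxx; congr (_ * _).
  by rewrite /=; field; rewrite g_neq0.
rewrite [RHS]big_mkcondl; apply: eq_bigr => k /negPf ki.
rewrite row_sum_fix_entry // ki; case: (A k j); rewrite ?subn1 ?subn0.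
  by field; rewrite e_neq0 g_neq0.
by field; rewrite e_neq0 g_neq0.
Qed.

Lemma row_weight_ge0 A i j : 0 <= row_weight R A j i.
Proof.
rewrite /row_weight; case: ifP => // _.
by rewrite divr_ge0 //; apply: prodr_ge0 => k _; rewrite divr_ge0 ?g_ge0 ?expR_ge0.
Qed.

Lemma sum_row_weight_le1 A j : ~~ blocked A j -> \sum_i row_weight R A j i <= 1.
Proof.
move=> unb; rewrite (bigID (fun i => A i j)) /= [X in _ + X]big1 ?addr0 => [|i /negPf Aij].
  rewrite (eq_bigr _ (fun i => row_weightE unb)).
  apply: sum_le_prod_g => [i _|i i' Ai Ai' ii']; first exact: unblocked_row_gt0 unb.
  exact: unblocked_row_eq1 unb _ _ _.
by rewrite /row_weight Aij.
Qed.

Lemma big_option (F : option 'I_n -> R) :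
  \sum_o F o = F None + \sum_i F (Some i).
Proof.
rewrite (bigD1 None) //=; congr (_ + _).
rewrite (reindex_omap (@Some 'I_n) id) /=; last by case.
by apply: eq_bigl => i; rewrite eqxx.
Qed.

Lemma well_posed_pass_step j st : well_posed (@pass_step R n j st).
Proof.
case: st => [[accept A] pi]; rewrite /pass_step; case: ifPn => //= unb; split.
- case=> [i|] /=; first exact: row_weight_ge0.
  by rewrite subr_ge0 sum_row_weight_le1.
- by rewrite big_option subrK.
- by case.
Qed.

Lemma well_posed_pass A : well_posed (pass R A).
Proof.
apply: well_posed_bind => [|[[accept B] pi]] //.
by apply: well_posed_foldM => j st; apply: well_posed_pass_step.
Qed.

Lemma well_posed_estimator A t : well_posed (estimator R A t).
Proof.
apply: well_posed_bind => //; apply: well_posed_foldM => _ N.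
by apply: well_posed_bind => [|[accept pi]] //; apply: well_posed_pass.
Qed.

Lemma row_sum1_eq A i j l : row_sum A i = 1%N -> A i j -> A i l = (l == j).
Proof.
move=> rAi Aij; have [->//|lj] := eqVneq l j.
have := row_sumD1 A i j; rewrite rAi Aij (bigD1 l) //=.
by case: (A i l).
Qed.

Lemma prod_zero_one A (s : 'S_n) :
  \prod_i zero_one_mx R A i (s i) = [forall i, A i (s i)]%:R.
Proof.
have [/forallP As|/forallPn[i /negPf Ai]] := boolP [forall i, A i (s i)].
  by rewrite big1 // => i _; rewrite mxE As.
by rewrite (bigD1 i) //= mxE Ai mul0r.
Qed.

Lemma per_zero_one A :
  per (zero_one_mx R A) = \sum_(s : 'S_n) [forall i, A i (s i)]%:R.
Proof. by apply: eq_bigr => s _; apply: prod_zero_one. Qed.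

(** Permutations are sorted by the row matched to column [j]. Those with [s i = j] avoid the zeros
    of [A] exactly when they avoid those of [fix_entry A i j]. *)
Lemma per_fix_entry A j :
  per (zero_one_mx R A) = \sum_(i | A i j) per (zero_one_mx R (fix_entry A i j)).
Proof.
rewrite per_zero_one (partition_big (fun s : 'S_n => (s^-1)%g j) predT) //=.
rewrite [RHS]big_mkcond; apply: eq_bigr => i _.
have def_s (s : 'S_n) : ((s^-1)%g j == i) = (s i == j).
  by rewrite (canF_eq (permKV s)) eq_sym.
rewrite (eq_bigl _ _ def_s); case: ifPn => Aij; last first.
  rewrite big1 // => s /eqP sij; case: forallP => // /(_ i).
  by rewrite sij (negPf Aij).
rewrite per_zero_one [LHS]big_mkcond; apply: eq_bigr => s _.
case: eqP => [sij|/eqP sij]; last first.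
  by case: forallP => // /(_ i); rewrite mxE eqxx (negPf sij).
congr (_%:R); congr (nat_of_bool _); apply: eq_forallb => k; rewrite mxE.
have [->|ki] := eqVneq k i; first by rewrite sij eqxx.
by rewrite -sij (inj_eq perm_inj) (negPf ki).
Qed.

(** An empty row, or two rows whose only entry lies in the same column, excludes any perfect
    matching: rejecting here loses nothing. *)
Lemma per_blocked A j : blocked A j -> per (zero_one_mx R A) = 0.
Proof.
move=> bA; rewrite per_zero_one big1 // => s _; case: forallP => // As.
have row_s i : row_sum A i = 1%N -> A i j -> s i = j.
  by move=> rAi Aij; have := As i; rewrite (row_sum1_eq _ rAi Aij) => /eqP.
case/orP: bA => [/existsP|/existsP]; case=> i.
  by rewrite (row_sumD1 _ i (s i)) As.
case/existsP=> i' /and5P[ii' Ai Ai' /eqP ri /eqP ri']; case/eqP: ii'.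
by apply: (@perm_inj _ s); rewrite !row_s.
Qed.

(** Invariant of a column already treated: it has a single entry, which is also alone in its row.
    When all columns are settled, the matrix is a permutation matrix. *)
Definition settled A j :=
  exists i, [/\ A i j, row_sum A i = 1%N & forall k, A k j -> k = i].

Lemma settled_fix_entry A i j : A i j -> settled (fix_entry A i j) j.
Proof.
move=> Aij; exists i; split; first by rewrite mxE !eqxx.
  by rewrite row_sum_fix_entry // eqxx.
by move=> k; rewrite mxE eqxx andbT orbT; case: eqP.
Qed.

Lemma settled_fix_entry_neq A i j j' : A i j -> j' != j -> settled A j' ->
  settled (fix_entry A i j) j'.
Proof.
move=> Aij jj' [i' [Ai' ri' uniq_i']].
have ii' : i' != i.
  apply: contraNneq jj' => def_i; rewrite def_i in ri' Ai'.
  by rewrite -(row_sum1_eq _ ri' Aij).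
exists i'; split.
- by rewrite mxE (negPf ii') (negPf jj').
- rewrite row_sum_fix_entry // (negPf ii') ri' (row_sum1_eq _ ri' Ai').
  by rewrite eq_sym (negPf jj').
- by move=> k; rewrite mxE (negPf jj') andbF orbF; case: eqP => // _ /uniq_i'.
Qed.

Lemma Mtilde_per_settled A : (forall j, settled A j) ->
  Mtilde R A = 1 /\ per (zero_one_mx R A) = 1.
Proof.
move=> /choice[p p_A].
have p_inj : injective p.
  move=> j j' pj; have [Aj rj _] := p_A j; have [Aj' _ _] := p_A j'.
  by have := row_sum1_eq j' rj Aj; rewrite pj Aj' => /esym/eqP.
pose q := (perm p_inj)^-1%g.
have pq i : p (q i) = i by rewrite -[p _](permE p_inj) permKV.
have rA i : row_sum A i = 1%N by have [_ + _] := p_A (q i); rewrite pq.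
have Aq i : A i (q i) by have [+ _ _] := p_A (q i); rewrite pq.
split.
  by apply: big1 => i _; rewrite rA divff // gt_eqF ?expR_gt0.
rewrite per_zero_one (bigD1 q) //= [X in _ + X]big1 ?addr0 => [|s sq].
  by case: forallP => // -[].
case: forallP => // As; case/eqP: sq; apply/permP => i; apply/eqP.
by rewrite -(row_sum1_eq _ (rA i) (Aq i)).
Qed.

Lemma expect_rejected xs A pi :
  expect (foldM xs (@pass_step R n) (false, A, pi)) (fun st => st.1.1%:R) = 0.
Proof.
elim: xs A pi => //= j xs IHxs A pi; rewrite expect_bind; case: ifP => //= _.
by apply: big1 => -[i|] _ /=; rewrite IHxs mulr0.
Qed.

(** Induction on the columns still to be treated. Multiplying the probability of row [i] by
    [Mtilde R A] leaves [Mtilde] of the next matrix, so the sum over [i] is the expansion of the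
    permanent along column [j]. At the end both sides are 1. *)
Lemma Mtilde_expect_accept xs A pi : (forall j, j \notin xs -> settled A j) ->
  Mtilde R A * expect (foldM xs (@pass_step R n) (true, A, pi)) (fun st => st.1.1%:R)
  = per (zero_one_mx R A).
Proof.
elim: xs A pi => [|j xs IHxs] A pi set_A /=.
  by have [|-> ->] := @Mtilde_per_settled A; rewrite ?mulr1 // => j; apply: set_A.
rewrite expect_bind; case: ifPn => [bA|unb] /=.
  by rewrite expect_rejected mulr0 (per_blocked bA).
rewrite big_option /= expect_rejected mulr0 add0r (per_fix_entry A j) mulr_sumr.
rewrite [RHS]big_mkcond; apply: eq_bigr => i _ /=.
rewrite /row_weight; case: ifPn => Aij; last by rewrite mul0r mulr0.
have M_gt0 : 0 < Mtilde R A.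
  by apply: Mtilde_gt0 => k; apply: unblocked_row_gt0 unb.
rewrite mulrA mulrCA divff ?gt_eqF // mulr1 IHxs // => j' j'xs.
have [->|jj'] := eqVneq j' j; first exact: settled_fix_entry.
by apply: settled_fix_entry_neq => //; apply: set_A; rewrite inE negb_or jj'.
Qed.

Lemma Mtilde_prob_accept A :
  Mtilde R A * prob (pass R A) fst = per (zero_one_mx R A).
Proof.
rewrite -(@Mtilde_expect_accept (enum 'I_n) A [ffun=> None]) => [|j].
  by congr (_ * _); rewrite /prob expect_bind; apply: eq_expect => -[[]].
by rewrite mem_enum.
Qed.

End Pass.

(** * Correctness and running time of the program *)

Section Program.
Local Open Scope comp_scope.
Variables (R : realType) (n : nat).
Implicit Types (A : 'M[bool]_n) (i j k : 'I_n).
Local Notation g := (@g R).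

Ltac run_ops := rewrite /op /=; repeat apply: simulates_op.

Lemma runs_loop_enum (S : Type) (Inv : seq 'I_n -> S -> Prop) (Q : S -> Prop)
    (body : 'I_n -> S -> comp R S) (k : nat) s :
  (forall xs1 x xs2 s, enum 'I_n = xs1 ++ x :: xs2 -> Inv xs1 s ->
     runs (body x s) (Inv (rcons xs1 x)) k) ->
  Inv [::] s -> (forall s, Inv (enum 'I_n) s -> Q s) ->
  runs (loop (enum 'I_n) body s) Q (n * k.+1).
Proof.
move=> run_b Inv0 InvQ; apply: (runs_weaken (runs_loop run_b Inv0)) => //.
by rewrite size_enum_ord.
Qed.

Definition table_ok (tab : table R) := forall a, (a <= n)%N -> tab a = g a.

Lemma runs_g_table : runs (g_table R n) table_ok (n.-1 * 11).+2.
Proof.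
rewrite /g_table; run_ops.
have [n0|n_gt0] := posnP n.
  rewrite n0 /loop /=; apply: SimRet => a; rewrite n0 leqn0 => /eqP ->.
  by rewrite /upd_table.
have -> : (n.-1 * 11 = size (iota 1 n.-1) * 11)%N by rewrite size_iota.
(* Entries 0 and 1 are filled before the loop, so the table is always one entry ahead of the
   prefix. *)
pose Inv := fun (xs : seq nat) (tab : table R) =>
  forall a, (a <= (size xs).+1)%N -> tab a = g a.
apply: (runs_weaken (runs_loop (Inv := Inv) (k := 10) _ _)) => //.
- move=> xs1 a xs2 tab def_xs Inv_tab.
  have def_a : a = (size xs1).+1.
    have := nth_iota 0%N 1 (_ : (size xs1 < n.-1)%N).
    rewrite def_xs nth_cat ltnn subnn /= add1n => -> //.
    by rewrite -(size_iota 1 n.-1) def_xs size_cat /= -addSnnS leq_addr.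
  run_ops; apply: SimRet => b; rewrite size_rcons /upd_table => le_b.
  case: eqP => [->|/eqP ba].
    by rewrite Inv_tab ?gS def_a.
  rewrite def_a in ba; apply: Inv_tab; move: le_b.
  by rewrite leq_eqVlt (negPf ba).
- case=> [|[|a]] //=.
- move=> tab Inv_tab a le_a; apply: Inv_tab; rewrite size_iota; lia.
Qed.

Definition rows_ok A (r : array n nat) := forall i, r i = row_sum A i.

Lemma row_sum_le A i : (row_sum A i <= n)%N.
Proof.
rewrite /row_sum -[X in (_ <= X)%N]card_ord -sum1_card; apply: leq_sum => l _.
by case: (A i l).
Qed.

Lemma runs_row_sums_prog A :
  runs (row_sums_prog R A) (rows_ok A) (n + n * (n * 3).+2).
Proof.
rewrite /row_sums_prog; apply: SimTick => /=.
pose Inv := fun (xs : seq 'I_n) (r : array n nat) => forall i, i \in xs -> r i = row_sum A i.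
apply: (runs_loop_enum (Inv := Inv)) => //.
- move=> xs1 i xs2 r def_xs Inv_r; rewrite -[(n * 3).+1]addn1.
  apply: (runs_bind (Q := fun s => s = row_sum A i)).
    pose Inv' := fun (ys : seq 'I_n) s => s = (\sum_(j <- ys) A i j)%N.
    apply: (runs_loop_enum (Inv := Inv')).
    + move=> ys1 j ys2 s _ ->; run_ops; apply: SimRet.
      by rewrite /Inv' -cats1 big_cat big_seq1.
    + by rewrite /Inv' big_nil.
    + by move=> s ->; rewrite big_enum.
  move=> s ->; run_ops; apply: SimRet => k; rewrite mem_rcons inE ffunE.
  by case: eqP => [->|_] //= /Inv_r.
- by move=> r Inv_r i; apply: Inv_r; rewrite mem_enum.
Qed.

Lemma runs_blocked_prog A r j : rows_ok A r ->
  runs (blocked_prog R A r j) (fun b => b = blocked A j) (n * 8).+2.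
Proof.
move=> r_ok; rewrite /blocked_prog -[(n * 8).+2]addn2.
apply: (runs_bind (Q := fun acc : bool * nat =>
    acc.1 = [exists i, row_sum A i == 0%N] /\
    acc.2 = #|[set i | A i j & row_sum A i == 1%N]|)).
  pose Inv := fun (xs : seq 'I_n) (acc : bool * nat) =>
    acc.1 = has (fun i => row_sum A i == 0%N) xs /\
    acc.2 = count (fun i => A i j && (row_sum A i == 1%N)) xs.
  apply: (runs_loop_enum (Inv := Inv)) => //.
  - move=> xs1 i xs2 [zero ones] _ [/= -> ->]; run_ops; apply: SimRet.
    by split; rewrite /= -cats1 ?has_cat ?count_cat /= ?orbF ?addn0 r_ok // andbC.
  - case=> zero ones [/= -> ->]; split.
      apply/hasP/existsP => [[i _ ri]|[i ri]]; exists i => //.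
      by rewrite mem_enum.
    by rewrite -sum1_count big_enum_cond -sum1_card; apply: eq_bigl => i; rewrite inE.
move=> [zero ones] [/= -> ->]; run_ops; apply: SimRet; congr (_ || _).
apply/card_gt1P/existsP => [[i [i' [+ + ii']]]|[i /existsP[i' /and5P[ii' Ai Ai' ri ri']]]].
  rewrite !inE => /andP[Ai ri] /andP[Ai' ri']; exists i; apply/existsP; exists i'.
  by rewrite ii' Ai Ai' ri.
by exists i, i'; rewrite !inE Ai Ai' ri.
Qed.

Lemma runs_fix_entry_prog A r i j : A i j -> rows_ok A r ->
  runs (fix_entry_prog R A r i j)
    (fun Br => Br.1 = fix_entry A i j /\ rows_ok (fix_entry A i j) Br.2)
    (n * 7 + (n * 3 + 1)).
Proof.
move=> Aij r_ok; rewrite /fix_entry_prog.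
pose B (xs : seq 'I_n) : 'M[bool]_n :=
  \matrix_(k, l) if [&& k \in xs, k != i & l == j] then false else A k l.
pose D := B (enum 'I_n).
(* Row [i] is left out: its stored sum is still the old one and becomes 1 only after the second
   loop. *)
apply: (runs_bind (Q := fun Br : 'M[bool]_n * array n nat =>
    Br.1 = D /\ forall k, k != i -> Br.2 k = row_sum (fix_entry A i j) k)).
  pose Inv := fun (xs : seq 'I_n) (Br : 'M[bool]_n * array n nat) =>
    Br.1 = B xs /\ forall k, Br.2 k =
      if (k \in xs) && (k != i) then (row_sum A k - A k j)%N else row_sum A k.
  apply: (runs_loop_enum (Inv := Inv)).
  - move=> xs1 k xs2 [C r'] def_xs [/= -> def_r].
    have k_xs1 : k \notin xs1.
      have := enum_uniq 'I_n; rewrite def_xs cat_uniq /= negb_or.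
      by move=> /and3P[_ /andP[]].
    have Bk l : B xs1 k l = A k l by rewrite mxE (negPf k_xs1).
    run_ops; case: eqP => [ki|/eqP ki].
      apply: SimRet; split=> /= [|k'].
        apply/matrixP => k' l; rewrite !mxE mem_rcons inE.
        by case: (k' =P k) => [->|_] //=; rewrite ki eqxx /= ?andbF.
      rewrite def_r mem_rcons inE; case: (k' =P k) => [->|_] //=.
      by rewrite ki eqxx andbF.
    run_ops; rewrite Bk; case: ifP => Akj; run_ops; apply: SimRet; split=> /= [|k'].
    + apply/matrixP => k' l; rewrite !mxE mem_rcons inE.
      by case: (k' =P k) => [->|_] //=; rewrite ki (negPf k_xs1) /=; case: eqP.
    + rewrite ffunE mem_rcons inE !def_r; case: (k' =P k) => [->|_] //=.
      by rewrite ki (negPf k_xs1) Akj subn1.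
    + apply/matrixP => k' l; rewrite !mxE mem_rcons inE.
      case: (k' =P k) => [->|_] //=; rewrite ki (negPf k_xs1) /=.
      by case: eqP => // ->.
    + rewrite mem_rcons inE def_r; case: (k' =P k) => [->|_] //=.
      by rewrite ki (negPf k_xs1) Akj subn0.
  - by split=> [|k] /=; [apply/matrixP => k l; rewrite mxE | rewrite r_ok].
  - move=> [C r'] [/= -> def_r]; split=> // k ki.
    by rewrite def_r mem_enum ki row_sum_fix_entry // (negPf ki).
move=> [C r'] [/= -> def_r].
apply: (runs_bind (Q := fun C => C = fix_entry A i j)).
  pose Inv := fun (xs : seq 'I_n) (C : 'M[bool]_n) => C =
    \matrix_(k, l) if [&& l \in xs, l != j & k == i] then false else D k l.
  apply: (runs_loop_enum (Inv := Inv)).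
  - move=> xs1 l xs2 _ def_xs ->; run_ops; case: eqP => [lj|/eqP lj]; run_ops; apply: SimRet.
      apply/matrixP => k l'; rewrite !mxE mem_rcons inE.
      by case: (l' =P l) => [->|_] //=; rewrite lj eqxx andbF.
    apply/matrixP => k l'; rewrite !mxE mem_rcons inE.
    case: (l' =P l) => [->|_] //=; rewrite ?lj /= ?andbT ?andbF //.
    by case: (k == i); rewrite ?andbF.
  - by apply/matrixP => k l; rewrite !mxE.
  - move=> _ ->; apply/matrixP => k l; rewrite !mxE !mem_enum /=.
    by case: (k =P i) => [->|_]; case: (l =P j) => [->|_].
move=> _ ->; run_ops; apply: SimRet; split=> //= k; rewrite ffunE.
by case: eqP => [->|/eqP/def_r //]; rewrite row_sum_fix_entry // eqxx.
Qed.

(** The product over the rows other than [i] is a prefix times a suffix product. Dividing the full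
    product by [q i] would not do, as [q i = g 0 / g 1 = 0] for a row of sum 1 meeting column
    [j]. *)
Lemma runs_weights_prog tab A r j : table_ok tab -> rows_ok A r -> ~~ blocked A j ->
  runs (weights_prog tab A r j)
    (fun wr : array n R * R => (forall i, wr.1 i = row_weight R A j i) /\
       wr.2 = 1 - \sum_i row_weight R A j i) (n * 28 + 1).
Proof.
move=> tab_ok r_ok unb; rewrite /weights_prog.
pose q i := if A i j then g (row_sum A i).-1 / g (row_sum A i) else 1.
have row_le i : (row_sum A i <= n)%N := row_sum_le A i.
have row_gt0 i : (0 < row_sum A i)%N := unblocked_row_gt0 i unb.
have tab_r i : tab (r i) = g (row_sum A i) by rewrite r_ok tab_ok.
have tab_r1 i : tab (r i).-1 = g (row_sum A i).-1.
  by rewrite r_ok tab_ok // (leq_trans (leq_pred _)).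
apply: (@simulates_le _ _ _ _ _ _ (n + (n * 8 + (n + (n * 4 + (n + (n * 13 + 1))))))).
  by lia.
apply: SimTick => /=.
apply: (runs_bind (Q := fun q' : array n R => forall i, q' i = q i)).
  pose Inv := fun (xs : seq 'I_n) (q' : array n R) =>
    forall i, q' i = if i \in xs then q i else 1.
  apply: (runs_loop_enum (Inv := Inv)).
  - move=> xs1 i xs2 q' _ def_q; run_ops; case: ifP => Aij; run_ops; apply: SimRet => k.
      rewrite ffunE mem_rcons inE tab_r tab_r1; case: (k =P i) => [->|_] //=.
      by rewrite /q Aij.
    rewrite mem_rcons inE def_q; case: (k =P i) => [->|_] //=.
    by rewrite /q Aij; case: ifP.
  - by move=> i; rewrite ffunE.
  - by move=> q' def_q i; rewrite def_q mem_enum.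
move=> q' def_q; apply: SimTick => /=.
pose pre i := \prod_(k <- take (index i (enum 'I_n)) (enum 'I_n)) q k.
apply: (runs_bind (Q := fun acc : array n R * R => forall i, acc.1 i = pre i)).
  pose Inv := fun (xs : seq 'I_n) (acc : array n R * R) =>
    (forall i, i \in xs -> acc.1 i = pre i) /\ acc.2 = \prod_(k <- xs) q k.
  apply: (runs_loop_enum (Inv := Inv)).
  - move=> xs1 i xs2 [pre' p] def_xs [/= def_pre ->]; run_ops; apply: SimRet.
    have i_xs1 : i \notin xs1.
      have := enum_uniq 'I_n; rewrite def_xs cat_uniq /= negb_or.
      by move=> /and3P[_ /andP[]].
    split=> [k|] /=; last by rewrite -cats1 big_cat big_seq1 def_q.
    rewrite ffunE mem_rcons inE; case: (k =P i) => [-> _|_ /def_pre //].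
    by rewrite /pre def_xs index_cat (negPf i_xs1) /= eqxx addn0 take_size_cat.
  - by split=> [i|] /=; rewrite ?big_nil.
  - by move=> [pre' p] [/= def_pre _] i; rewrite def_pre ?mem_enum.
move=> [pre' p] /= def_pre; apply: SimTick => /=.
(* The last loop runs backwards: [ys1] holds the rows after [i], already visited, and [ys2] those
   before [i]. *)
have weightE i ys1 ys2 : A i j -> rev (enum 'I_n) = ys1 ++ i :: ys2 ->
    g 1 / g (row_sum A i) * pre i * \prod_(k <- ys1) q k = row_weight R A j i.
  move=> Aij def_ys; rewrite row_weightE // -mulrA; congr (_ * _).
  have def_xs : enum 'I_n = rev ys2 ++ i :: rev ys1.
    by rewrite -(revK (enum 'I_n)) def_ys rev_cat rev_cons cat_rcons.
  have := enum_uniq 'I_n; rewrite def_xs cat_uniq /= negb_or.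
  move=> /and3P[_ /andP[i2 _] /andP[i1 _]].
  have filter_id (s : seq 'I_n) : i \notin s -> [seq k <- s | k != i] = s.
    by move=> i_s; apply/all_filterP/allP => k ks; apply: contraNneq i_s => <-.
  rewrite /pre def_xs index_cat (negPf i2) /= eqxx addn0 take_size_cat //.
  rewrite [RHS]big_mkcondl.
  transitivity (\prod_(k <- enum 'I_n | k != i) q k); last by rewrite big_enum_cond.
  rewrite -[RHS]big_filter def_xs filter_cat /= eqxx !filter_id // big_cat; congr (_ * _).
  by apply: perm_big; rewrite perm_sym perm_rev.
rewrite -[(n * 13 + 1)%N]/(n * 12.+1 + 1)%N.
apply: (runs_bind (Q := fun acc : array n R * R * R =>
    (forall i, acc.1.1 i = row_weight R A j i) /\ acc.2 = \sum_i row_weight R A j i)).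
  pose Inv := fun (ys : seq 'I_n) (acc : array n R * R * R) =>
    [/\ forall i, acc.1.1 i = if i \in ys then row_weight R A j i else 0,
        acc.1.2 = \prod_(k <- ys) q k & acc.2 = \sum_(k <- ys) row_weight R A j k].
  have -> : (n * 13 = size (rev (enum 'I_n)) * 13)%N by rewrite size_rev size_enum_ord.
  apply: (runs_weaken (runs_loop (Inv := Inv) (k := 12) _ _)) => //.
  - move=> ys1 i ys2 [[w suf] total] def_ys [/= def_w -> ->].
    run_ops; case: ifP => Aij; run_ops; apply: SimRet.
      rewrite def_pre tab_r tab_ok ?(leq_trans (row_gt0 i)) // (weightE _ _ _ Aij def_ys).
      split=> [k| |] /=; rewrite -cats1 ?big_cat ?big_seq1 ?def_q //.
      rewrite ffunE mem_cat inE def_w; case: (k =P i) => [->|_]; rewrite ?orbT ?orbF //.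
    have w0 : row_weight R A j i = 0 by rewrite /row_weight Aij.
    split=> [k| |] /=; rewrite -cats1 ?big_cat ?big_seq1 ?def_q ?w0 /= ?addr0 //.
    rewrite mem_cat inE def_w; case: (k =P i) => [->|_]; rewrite ?orbT ?orbF //.
    by rewrite w0; case: ifP.
  - by split=> [i| |] /=; rewrite ?ffunE ?big_nil.
  - move=> [[w suf] total] [/= def_w _ ->]; split=> [i|].
      by rewrite def_w mem_rev mem_enum.
    by rewrite -[RHS]big_enum; apply: perm_big; rewrite perm_rev.
move=> [[w suf] total] [/= def_w ->]; run_ops; exact: SimRet.
Qed.

Definition same_state (sp : prog_state n) (s : pass_state n) :=
  let: (accept, A, r, pi) := sp in s = (accept, A, pi) /\ rows_ok A r.

Lemma simulates_pass_step tab j sp s : table_ok tab -> same_state sp s ->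
  simulates same_state (pass_step_prog tab j sp) (pass_step R j s) (n * 47 + 8).
Proof.
move=> tab_ok; case: sp => [[[accept A] r] pi] [-> r_ok]; rewrite /pass_step_prog /pass_step.
lazy beta iota.
apply: (@simulates_le _ _ _ _ _ _ ((n * 8).+2 + (n * 39 + 6))); first by lia.
apply: (runs_bind (runs_blocked_prog j r_ok)) => _ ->; case: ifPn => [_|unb].
  have -> : (n * 39 + 6 = (n * 39 + 5).+1)%N by lia.
  by run_ops; constructor.
apply: (@simulates_le _ _ _ _ _ _ ((n * 28 + 1) + (n.+1 + (n * 7 + (n * 3 + 1)).+1))).
  by lia.
apply: (runs_bind (runs_weights_prog tab_ok r_ok unb)) => -[w rest] [/= def_w ->].
apply: SimChoose => [[i|]|[i|]] //=.
  rewrite /row_weight; case: ifP => [Aij _|_]; last by rewrite eqxx.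
  run_ops; rewrite -[(n * 7 + (n * 3 + 1))%N]addn0.
  apply: (runs_bind (runs_fix_entry_prog Aij r_ok)) => -[B r'] [/= -> r'_ok].
  by constructor.
by move=> _; run_ops; constructor.
Qed.

Lemma simulates_pass tab A : table_ok tab ->
  simulates eq (pass_prog tab A) (pass R A) (n * n * 64).
Proof.
move=> tab_ok; rewrite /pass_prog /pass.
apply: (@simulates_le _ _ _ _ _ _
  (n * n + ((n + n * (n * 3).+2) + (n + (n * (n * 47 + 8).+1 + 0))))); first by nia.
apply: SimTick; lazy beta iota; apply: (runs_bind (runs_row_sums_prog A)) => r r_ok.
apply: SimTick => /=.
apply: (@simulates_bind _ _ _ _ _ same_state).
  rewrite -[X in (X * _)%N](size_enum_ord n); apply: simulates_loop => //.
  by move=> j sp s; apply: simulates_pass_step.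
by move=> [[[accept B] r'] pi] s [-> _]; constructor.
Qed.

Lemma runs_Mtilde_prog tab A (r : array n nat) : table_ok tab -> rows_ok A r ->
  runs (loop (enum 'I_n) (fun i M =>
    let* s := op R (r i) in
    let* x := op R (tab s) in
    let* x := op R (x / expR 1) in
    op R (M * x)) 1) (fun M => M = Mtilde R A) (n * 5).
Proof.
move=> tab_ok r_ok.
pose Inv := fun (xs : seq 'I_n) (M : R) =>
  M = \prod_(i <- xs) (g (row_sum A i) / expR 1).
apply: (runs_loop_enum (Inv := Inv)).
- move=> xs1 i xs2 M _ ->; run_ops; apply: SimRet.
  by rewrite /Inv -cats1 big_cat big_seq1 r_ok tab_ok ?row_sum_le.
- by rewrite /Inv big_nil.
- by move=> M ->; rewrite big_enum.
Qed.

(** As [n] and [t] are positive, the work done once, for the table of [g] and for [Mtilde A], is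
    absorbed by the cost of the passes. *)
Lemma simulates_estimator A t : (0 < n)%N -> (0 < t)%N ->
  simulates eq (estimator_prog R A t) (estimator R A t) (t * n * n * 100).
Proof.
move=> n_gt0 t_gt0; rewrite /estimator_prog /estimator.
apply: (@simulates_le _ _ _ _ _ _ ((n.-1 * 11).+2 +
  (t * (n * n * 64 + 1).+1 + ((n + n * (n * 3).+2) + (n * 5 + 2))))); first by nia.
apply: (runs_bind runs_g_table) => tab tab_ok.
apply: (@simulates_bind _ _ _ _ _ eq).
  rewrite -[X in (X * _)%N](size_iota 0 t); apply: simulates_loop => // _ N _ <-.
  apply: (simulates_bind (simulates_pass A tab_ok)) => -[accept pi] _ <-.
  by run_ops; constructor.
move=> N _ <-; apply: (runs_bind (runs_row_sums_prog A)) => r r_ok.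
apply: (runs_bind (runs_Mtilde_prog tab_ok r_ok)) => _ ->.
by run_ops; constructor.
Qed.

End Program.

(** * Concentration *)

Section Chernoff.
Local Open Scope comp_scope.
Variable R : realType.

Lemma expR_le_quad (x : R) : -1 <= x <= 1 / 2 -> expR x <= 1 + x + x ^+ 2.
Proof.
move=> /andP[x_ge x_le]; have [x_ge0|x_lt0] := leP 0 x.
  have x01 : 0 <= x <= 1 by apply/andP; split; lra.
  by apply: le_trans (expR_le_cubic x01) _; nra.
(* For [x < 0]: [expR (- x) >= 1 - x] and [(1 - x) * (1 + x + x^2) = 1 - x^3 >= 1]. *)
rewrite -[x in expR x]opprK expRN -[leRHS]invrK.
have := expR_ge1Dx (- x) => le_e.
have q_gt0 : 0 < 1 + x + x ^+ 2 by nra.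
rewrite lef_pV2 ?posrE ?invr_gt0 ?expR_gt0 //; apply: le_trans le_e.
by rewrite -div1r ler_pdivrMr //; nra.
Qed.

Lemma prob_ge0 (T : Type) (c : comp R T) (E : pred T) : well_posed c -> 0 <= prob c E.
Proof. by move=> wc; rewrite -[leLHS](expect_const 0 wc); apply: le_expect. Qed.

Lemma prob_le1 (T : Type) (c : comp R T) (E : pred T) : well_posed c -> prob c E <= 1.
Proof.
move=> wc; rewrite -[leRHS](expect_const 1 wc); apply: le_expect => // x.
by case: (E x); rewrite ?ler01.
Qed.

Variables (T : Type) (c : comp R T) (E : pred T).
Hypothesis wc : well_posed c.
Local Notation p := (prob c E).

Definition count_accepts (t N : nat) : comp R nat :=
  foldM (iota 0%N t) (fun _ N => let* x := c in Ret (N + E x)%N) N.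

(** Generating function of the binomial law with parameters [t] and [p], shifted by [N];
    independence of the passes enters here. *)
Lemma expect_pow_count (u : R) t N :
  expect (count_accepts t N) (fun k => u ^+ k) = u ^+ N * (1 + p * (u - 1)) ^+ t.
Proof.
rewrite /count_accepts; elim: t 0%N N => [|t IHt] m N /=; first by rewrite expr0 mulr1.
rewrite !expect_bind /=.
have step (x : T) : expect (foldM (iota m.+1 t) (fun _ N => let* x := c in Ret (N + E x)%N)
    (N + E x)%N) (fun k => u ^+ k) =
    (u ^+ N * (1 + p * (u - 1)) ^+ t * (u - 1)) * (E x)%:R
      + u ^+ N * (1 + p * (u - 1)) ^+ t.
  by rewrite IHt; case: (E x); rewrite ?addn1 ?addn0 ?exprS /=; ring.
under [in LHS]eq_expect do rewrite step.
by rewrite expect_linear expect_const // -/(prob c E) exprS; ring.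
Qed.

Lemma expect_expR_count (s : R) t : 
  expect (count_accepts t 0) (fun k => expR (s * k%:R)) <= expR (p * t%:R * (expR s - 1)).
Proof.
rewrite (eq_expect _ (fun k => expRM_natr k s)) expect_pow_count expr0 mul1r.
have -> : p * t%:R * (expR s - 1) = (p * (expR s - 1)) * t%:R by ring.
rewrite expRM_natr lerXn2r ?nnegrE ?expR_ge0 ?expR_ge1Dx //.
have := expR_gt0 s; have := prob_ge0 E wc; have := prob_le1 E wc; nra.
Qed.

Lemma well_posed_count t N : well_posed (count_accepts t N).
Proof. by apply: well_posed_foldM => _ k; apply: well_posed_bind. Qed.

Lemma chernoff_count (sigma : R) t : 0 < sigma -> sigma < 1 ->
  1 - 2 * expR (- (sigma ^+ 2 * p * t%:R / 16)) <=
  expect (count_accepts t 0)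
    (fun k : nat => ((1 + sigma)^-1 * (p * t%:R) <= k%:R <= (1 + sigma) * (p * t%:R))%R%:R).
Proof.
move=> sigma_gt0 sigma_lt1; set q := p * t%:R.
pose good (k : nat) := ((1 + sigma)^-1 * q <= k%:R <= (1 + sigma) * q)%R.
have q_ge0 : 0 <= q by rewrite mulr_ge0 // prob_ge0.
(* [s = sigma / 4] minimizes [s^2 - s * sigma / 2], which bounds the exponent of the lower tail per
   unit of [q]; the minimum is [- sigma^2 / 16]. The upper tail has room to spare. *)
pose s := sigma / 4; pose U := expR (- (s * ((1 + sigma) * q))).
pose L := expR (s * ((1 + sigma)^-1 * q)).
have wN := well_posed_count t 0.
(* A pointwise lower bound for the indicator treats both tails at once: outside the interval one of
   the two exponentials is at least 1. *)
have le_good k : 1 - U * expR (s * k%:R) - L * expR (- s * k%:R) <= (good k)%:R.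
  have s_gt0 : 0 < s by rewrite /s; lra.
  rewrite /U /L -!expRD /good; case: (leP ((1 + sigma)^-1 * q)) => [_|lt_k];
    case: (leP k%:R ((1 + sigma) * q)) => [_|gt_k] /=.
  - by have := expR_ge0 (- (s * ((1 + sigma) * q)) + s * k%:R);
      have := expR_ge0 (s * ((1 + sigma)^-1 * q) + - s * k%:R); lra.
  - have : 1 <= expR (- (s * ((1 + sigma) * q)) + s * k%:R).
      rewrite -[leLHS]expR0 ler_expR addrC -mulrBr.
      by rewrite mulr_ge0 ?subr_ge0 ?(ltW s_gt0) ?(ltW gt_k).
    by have := expR_ge0 (s * ((1 + sigma)^-1 * q) + - s * k%:R); lra.
  - have : 1 <= expR (s * ((1 + sigma)^-1 * q) + - s * k%:R).
      rewrite -[leLHS]expR0 ler_expR mulNr -mulrBr.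
      by rewrite mulr_ge0 ?subr_ge0 ?(ltW s_gt0) ?(ltW lt_k).
    by have := expR_ge0 (- (s * ((1 + sigma) * q)) + s * k%:R); lra.
  - have : 1 <= expR (s * ((1 + sigma)^-1 * q) + - s * k%:R).
      rewrite -[leLHS]expR0 ler_expR mulNr -mulrBr.
      by rewrite mulr_ge0 ?subr_ge0 ?(ltW s_gt0) ?(ltW lt_k).
    by have := expR_ge0 (- (s * ((1 + sigma) * q)) + s * k%:R); lra.
apply: le_trans (le_expect wN le_good).
have -> : expect (count_accepts t 0)
    (fun k => 1 - U * expR (s * k%:R) - L * expR (- s * k%:R)) =
    1 - U * expect (count_accepts t 0) (fun k => expR (s * k%:R))
      - L * expect (count_accepts t 0) (fun k => expR (- s * k%:R)).
  transitivity (expect (count_accepts t 0) (fun k => (- L) * expR (- s * k%:R) +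
      ((- U) * expR (s * k%:R) + 1))); first by apply: eq_expect => k; ring.
  by rewrite !expect_linear expect_const //; ring.
have leU : U * expect (count_accepts t 0) (fun k => expR (s * k%:R)) <=
    expR (- (sigma ^+ 2 * p * t%:R / 16)).
  apply: le_trans (ler_wpM2l (expR_ge0 _) (expect_expR_count s t)) _.
  rewrite -expRD ler_expR -/q -[_ * p * _]mulrA -/q.
  have /expR_le_quad : -1 <= s <= 1 / 2 by apply/andP; split; rewrite /s; lra.
  by rewrite /s => le_e; nra.
have leL : L * expect (count_accepts t 0) (fun k => expR (- s * k%:R)) <=
    expR (- (sigma ^+ 2 * p * t%:R / 16)).
  apply: le_trans (ler_wpM2l (expR_ge0 _) (expect_expR_count (- s) t)) _.
  rewrite -expRD ler_expR -/q -[_ * p * _]mulrA -/q.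
  have /expR_le_quad : -1 <= - s <= 1 / 2 by apply/andP; split; rewrite /s; lra.
  have : (1 + sigma)^-1 <= 1 - sigma / 2.
    by rewrite -div1r ler_pdivrMr; nra.
  rewrite /s => le_i le_e.
  have : sigma / 4 * (1 + sigma)^-1 + (expR (- (sigma / 4)) - 1) <= - (sigma ^+ 2 / 16) by nra.
  by nra.
lra.
Qed.

End Chernoff.

(** * The van der Waerden bound *)

(** [f] picks the variable [f i] from the linear form of row [i]; the resulting monomial must have
    degree 1 in each variable of [J]. *)
Definition hits_once (n : nat) (J : {set 'I_n}) (f : {ffun 'I_n -> 'I_n}) : bool :=
  [forall j in J, #|f @^-1: [set j]| == 1%N].

(* The coefficient of [prod_(j in J) x_j] in [prod_i (sum_j A i j * x_j)], a
   polynomial in the remaining variables: a mixed derivative, evaluated at 0. *)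
Definition mixed (S : pzSemiRingType) (n : nat) (A : 'M[S]_n) (J : {set 'I_n})
    (x : 'I_n -> S) : S :=
  \sum_(f : {ffun 'I_n -> 'I_n} | hits_once J f)
    \prod_i (A i (f i) * (if f i \in J then 1 else x (f i))).

(** * Mixed derivatives of a product of linear forms *)

Section Mixed.
Variable n : nat.
Implicit Types (J : {set 'I_n}) (f : {ffun 'I_n -> 'I_n}).

Lemma mixed_ext (S : pzSemiRingType) (A : 'M[S]_n) J (x y : 'I_n -> S) :
  {in ~: J, x =1 y} -> mixed A J x = mixed A J y.
Proof.
move=> xy; apply: eq_bigr => f _; apply: eq_bigr => i _; congr (_ * _).
by case: ifPn => // fiJ; apply: xy; rewrite inE.
Qed.

Lemma mixed_set0 (S : comPzSemiRingType) (A : 'M[S]_n) (x : 'I_n -> S) :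
  mixed A set0 x = \prod_i \sum_j A i j * x j.
Proof.
rewrite bigA_distr_bigA; apply: eq_big => [f|f _].
  by apply/forall_inP => j; rewrite inE.
by apply: eq_bigr => i _; rewrite inE.
Qed.

Lemma hits_onceT f : hits_once setT f = injectiveb f.
Proof.
apply/forall_inP/injectiveP => [f1 i i' eq_f|f_inj j _].
  have /cards1P[k fk] := f1 (f i) (in_setT _).
  have : i \in f @^-1: [set f i] by rewrite !inE.
  have : i' \in f @^-1: [set f i] by rewrite !inE eq_f.
  by rewrite fk !inE => /eqP -> /eqP.
have /codomP[i ->] : j \in codom f.
  by apply: (inj_card_onto f_inj).
apply/cards1P; exists i; apply/setP => k; rewrite !inE.
by apply/eqP/eqP => [/f_inj|->].
Qed.

Lemma mixed_setT (S : pzSemiRingType) (A : 'M[S]_n) (x : 'I_n -> S) :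
  mixed A setT x = per A.
Proof.
rewrite /mixed /per (eq_bigl (fun f : {ffun _ -> _} => injectiveb f) _ hits_onceT).
rewrite (reindex (@pval _)) /=; last first.
  pose in_Sn := insubd (1%g : 'S_n).
  by exists in_Sn => /= [s _|f Uf]; [exact: valKd | exact: insubdK Uf].
apply: eq_big => [s|s _]; first by apply/injectiveP; rewrite pvalE; exact: perm_inj.
by apply: eq_bigr => i _; rewrite inE mulr1 pvalE.
Qed.

Lemma hits_onceU1 J k f : k \notin J ->
  hits_once (k |: J) f = hits_once J f && (#|f @^-1: [set k]| == 1%N).
Proof.
move=> kJ; apply/forall_inP/andP => [f1|[/forall_inP f1 fk] j].
  split; last by apply: f1; rewrite setU11.
  by apply/forall_inP => j jJ; apply: f1; rewrite !inE jJ orbT.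
by rewrite !inE => /predU1P[->|/f1].
Qed.

Lemma sum_card_fibres f : (\sum_j #|f @^-1: [set j]| = n)%N.
Proof.
transitivity (\sum_(i < n) 1)%N; last by rewrite sum1_card card_ord.
rewrite [RHS](partition_big f predT) //=.
by apply: eq_bigr => j _; rewrite -sum1_card; apply: eq_bigl => i; rewrite !inE.
Qed.

Lemma hits_once_card J f : hits_once J f ->
  (\sum_(j in ~: J) #|f @^-1: [set j]| = n - #|J|)%N.
Proof.
move=> /forall_inP f1; have := sum_card_fibres f.
rewrite (bigID [in J]) /= (eq_bigr (fun=> 1%N)); last by move=> j /f1/eqP.
rewrite sum1_card => def_n; rewrite -(addKn #|J| (\sum_(j in ~: J) _)).
congr (_ - _)%N; rewrite -[RHS]def_n; congr (_ + _)%N.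
by apply: eq_bigl => j; rewrite inE.
Qed.

Lemma card_fibre_le J k f : k \notin J -> hits_once J f ->
  (#|f @^-1: [set k]| <= n - #|J|)%N.
Proof.
move=> kJ /hits_once_card <-; rewrite (bigD1 k) ?inE //=; exact: leq_addr.
Qed.

Lemma card_fibre_max J k f : k \notin J -> hits_once J f ->
  (#|f @^-1: [set k]| == n - #|J|)%N = [forall i, f i \in k |: J].
Proof.
move=> kJ /hits_once_card <-; rewrite (bigD1 k) ?inE //=.
rewrite -{1}[#|_|]addn0 eqn_add2l eq_sym sum_nat_eq0.
apply/forall_inP/forallP => [f0 i|f0 j].
  rewrite -[_ \in _]negbK; apply/negP => fi.
  have /f0 : (f i \in ~: J) && (f i != k).
    by move: fi; rewrite !inE negb_or andbC.
  by rewrite cards_eq0 => /eqP/setP/(_ i); rewrite !inE eqxx.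
rewrite !inE => /andP[jJ jk]; rewrite cards_eq0 -subset0.
apply/subsetP => i; rewrite !inE => /eqP fij; have := f0 i.
by rewrite fij !inE (negPf jk) (negPf jJ).
Qed.

(** Homogeneity of degree [n - #|J|], since [f] hits [J] exactly [#|J|] times. It allows all
    variables to be rotated by a common complex factor. *)
Lemma mixed_scale (S : comPzSemiRingType) (A : 'M[S]_n) J (x : 'I_n -> S) c :
  mixed A J (fun j => c * x j) = c ^+ (n - #|J|) * mixed A J x.
Proof.
rewrite /mixed big_distrr /=; apply: eq_bigr => f f1.
have -> : (n - #|J| = #|f @^-1: ~: J|)%N.
  rewrite -(hits_once_card f1) -[RHS]sum1_card [RHS](partition_big f [in ~: J]) /=.
    apply: eq_bigr => j jJ; rewrite -sum1_card; apply: eq_bigl => i.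
    rewrite !inE; case: eqP => [->|_]; last by rewrite andbF.
    by move: jJ; rewrite inE => ->.
  by move=> i; rewrite !inE.
rewrite -prodr_const [in RHS]big_mkcond -big_split /=; apply: eq_bigr => i _.
by rewrite !inE; case: ifP => _ /=; rewrite ?mul1r // mulrCA.
Qed.

Lemma rmorph_mixed (S S' : comPzSemiRingType) (phi : {rmorphism S -> S'})
    (A : 'M[S]_n) J x :
  phi (mixed A J x) = mixed (map_mx phi A) J (phi \o x).
Proof.
rewrite rmorph_sum; apply: eq_bigr => f _; rewrite rmorph_prod.
apply: eq_bigr => i _; rewrite rmorphM mxE; congr (_ * _).
by case: ifP => //; rewrite rmorph1.
Qed.

Section MixedPoly.
Variables (C : comNzRingType) (A : 'M[C]_n).

(** The restriction to the variable [k], obtained as [mixed] over the polynomial ring; evaluation is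
    then a ring morphism applied to it. *)
Definition mixed_poly J k (x : 'I_n -> C) : {poly C} :=
  mixed (map_mx polyC A) J (fun j => if j == k then 'X else (x j)%:P).

Lemma horner_mixed_poly J k x t :
  (mixed_poly J k x).[t] = mixed A J (fun j => if j == k then t else x j).
Proof.
rewrite -/(horner_eval t _) rmorph_mixed.
have -> : map_mx (horner_eval t) (map_mx polyC A) = A.
  by apply/matrixP => i j; rewrite !mxE /= /horner_eval hornerC.
by apply: mixed_ext => j _ /=; case: ifP; rewrite /horner_eval ?hornerX ?hornerC.
Qed.

Lemma coef_mixed_poly J k x m : k \notin J ->
  (mixed_poly J k x)`_m =
  \sum_(f : {ffun 'I_n -> 'I_n} | hits_once J f && (#|f @^-1: [set k]| == m))
    \prod_i (A i (f i) * (if f i \in k |: J then 1 else x (f i))).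
Proof.
move=> kJ; rewrite /mixed_poly /mixed coef_sum [RHS]big_mkcondr.
apply: eq_bigr => f _.
have -> : \prod_i ((map_mx polyC A) i (f i) *
      (if f i \in J then 1 else if f i == k then 'X else (x (f i))%:P)) =
    (\prod_i (A i (f i) * (if f i \in k |: J then 1 else x (f i))))%:P
      * 'X^#|f @^-1: [set k]|.
  rewrite -prodr_const rmorph_prod [\prod_(i in _) 'X]big_mkcond -big_split /=.
  apply: eq_bigr => i _; rewrite mxE polyCM -mulrA !inE; congr (_ * _).
  case: eqP => [->|_] /=; first by rewrite (negPf kJ) mul1r.
  by rewrite mulr1; case: ifP.
by rewrite coefCM coefXn eq_sym; case: eqP; rewrite ?mulr1 ?mulr0.
Qed.

Lemma coef1_mixed_poly J k x : k \notin J ->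
  (mixed_poly J k x)`_1 = mixed A (k |: J) x.
Proof.
move=> kJ; rewrite coef_mixed_poly //; apply: eq_bigl => f.
by rewrite hits_onceU1.
Qed.

Lemma size_mixed_poly J k x : k \notin J ->
  (size (mixed_poly J k x) <= (n - #|J|).+1)%N.
Proof.
move=> kJ; apply/leq_sizeP => m lt_m; rewrite coef_mixed_poly // big_pred0 // => f.
apply/negP => /andP[/(card_fibre_le kJ) le_f /eqP def_m].
by rewrite -def_m ltnNge le_f in lt_m.
Qed.

(** Top degree in the variable [k] uses up all factors outside [J], so no other variable survives.
    The value at a unit vector is one to which [stable], with its boundary points, applies. *)
Lemma lead_mixed_poly J k x : k \notin J ->
  (mixed_poly J k x)`_(n - #|J|) = mixed A J (fun j => (j == k)%:R).
Proof.
move=> kJ; rewrite coef_mixed_poly //.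
rewrite [RHS](bigID (fun f : {ffun _ -> _} => [forall i, f i \in k |: J])) /=.
rewrite [X in _ + X]big1 ?addr0 => [|f /andP[_ /forallPn[i fi]]].
  apply: eq_big => [f|f /andP[f1]]; first exact: andb_id2l (card_fibre_max kJ).
  rewrite card_fibre_max // => /forallP f_J; apply: eq_bigr => i _.
  by rewrite f_J; case: ifPn (f_J i) => // /negPf; rewrite !inE orbC => -> /= ->.
rewrite (bigD1 i) //=; move: fi; rewrite !inE negb_or => /andP[/negPf-> /negPf->].
by rewrite mulr0 mul0r.
Qed.

End MixedPoly.

End Mixed.

(** * Low coefficients of a polynomial in terms of its roots *)

Section RootSums.
Variable F : fieldType.
Implicit Types (s : seq F) (r t : F).

Lemma coef0_prod_XsubC s :
  (\prod_(r <- s) ('X - r%:P))`_0 = \prod_(r <- s) (- r).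
Proof.
rewrite -horner_coef0 horner_prod; apply: eq_bigr => r _.
by rewrite hornerXsubC sub0r.
Qed.

(** The logarithmic derivative at 0. *)
Lemma coef1_prod_XsubC s : 0 \notin s ->
  (\prod_(r <- s) ('X - r%:P))`_1 =
  (\prod_(r <- s) (- r)) * \sum_(r <- s) - r^-1.
Proof.
elim: s => [|r s IHs]; first by rewrite !big_nil coef1 mulr0.
rewrite inE negb_or eq_sym => /andP[r0 /IHs def_s].
rewrite !big_cons mulrBl coefB coefXM coefCM /= def_s coef0_prod_XsubC.
by field.
Qed.

Lemma horner_prod_XsubC s t : 0 \notin s ->
  (\prod_(r <- s) ('X - r%:P)).[t] =
  (\prod_(r <- s) (- r)) * \prod_(r <- s) (1 + - r^-1 * t).
Proof.
rewrite -big_split horner_prod => s0; apply: eq_big_seq => r rs.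
rewrite hornerXsubC /=; field.
by apply: contraNneq s0 => <-.
Qed.

End RootSums.

(** AM-GM for the factors [1 + a], after padding [s] with zeros to length [m]. *)
Lemma prod_1D_le (F : numFieldType) (s : seq F) (m : nat) :
  all (>= 0) s -> (size s <= m)%N -> (0 < m)%N ->
  \prod_(a <- s) (1 + a) <= (1 + (\sum_(a <- s) a) / m%:R) ^+ m.
Proof.
move=> s_ge0 le_sm m_gt0; pose s' := s ++ nseq (m - size s) 0.
have size_s' : size s' = m by rewrite size_cat size_nseq subnKC.
have s'_ge0 : all (>= 0) s'.
  by rewrite all_cat s_ge0 all_nseq lexx orbT.
have -> : \prod_(a <- s) (1 + a) = \prod_(a <- s') (1 + a).
  rewrite big_cat [X in _ = _ * X]big1_seq ?mulr1 // => a /=.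
  by rewrite mem_nseq => /andP[_ /eqP->]; rewrite addr0.
have -> : \sum_(a <- s) a = \sum_(a <- s') a.
  rewrite big_cat [X in _ = _ + X]big1_seq ?addr0 // => a /=.
  by rewrite mem_nseq => /andP[_ /eqP->].
move: s' size_s' s'_ge0 m_gt0 {s_ge0 le_sm} => t <- t_ge0 t_gt0.
rewrite !(big_tnth _ _ t); set E := fun i => 1 + tnth (in_tuple t) i.
have [|le_E _] := @leif_AGM _ _ [set: 'I_(size t)] E.
  by move=> i _; rewrite addr_ge0 // (allP t_ge0) // mem_tnth.
have t0 : (size t)%:R != 0 :> F by rewrite pnatr_eq0 -lt0n.
move: le_E; rewrite big_split sumr_const cardsT card_ord /= mulrDl divff //.
rewrite (eq_bigl predT) => [|i]; last by rewrite inE.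
by rewrite (eq_bigl predT) => [|i]; last by rewrite inE.
Qed.

(** For [m > 1] the minimum of [(1 + S t / m)^m / t] over [t > 0] is [S] divided by this constant.
    At [m = 1] the exponent 0 makes it 1. *)
Definition gurvits_const (F : fieldType) (m : nat) : F :=
  (m.-1%:R / m%:R) ^+ m.-1.

(** * Capacity loss for one variable *)

Section Univariate.
Variable C : numClosedFieldType.

(** With all roots negative, [p.[t]] is [p.[0]] times a product of factors [1 + b t] with [b > 0],
    whose [b] sum to [S], the quotient of the two lowest coefficients. AM-GM bounds it by [p.[0] *
    (1 + S t / m)^m], to be compared with [c * t] at the best [t]. *)
Lemma gurvits_univariate (a c : C) (s : seq C) (m : nat) :
  let p := a *: \prod_(r <- s) ('X - r%:P) in
  all (< 0) s -> (size s <= m)%N -> (1 < m)%N -> 0 < p`_0 -> 0 <= c ->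
  (forall t, 0 < t -> c * t <= p.[t]) -> c * gurvits_const C m <= p`_1.
Proof.
move=> p s_lt0 le_sm m_gt1 p0_gt0 c_ge0 le_p.
have s0 : 0 \notin s by apply/negP => /(allP s_lt0) /=; rewrite ltxx.
pose b := [seq - r^-1 | r <- s].
have b_gt0 : all (> 0) b.
  rewrite all_map; apply: sub_all s_lt0 => r /= r_lt0.
  by rewrite oppr_gt0 invr_lt0.
have def_p0 : p`_0 = a * \prod_(r <- s) (- r) by rewrite coefZ coef0_prod_XsubC.
have def_p1 : p`_1 = p`_0 * \sum_(x <- b) x.
  by rewrite {1}/p coefZ coef1_prod_XsubC // def_p0 big_map mulrA.
have def_p t : p.[t] = p`_0 * \prod_(x <- [seq x * t | x <- b]) (1 + x).
  by rewrite {1}/p hornerZ horner_prod_XsubC // def_p0 !big_map mulrA.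
set S := \sum_(x <- b) x in def_p1.
have S_ge0 : 0 <= S.
  by rewrite /S big_seq sumr_ge0 // => x /(allP b_gt0)/ltW.
have m0 : m%:R != 0 :> C by rewrite pnatr_eq0; lia.
have m1_gt0 : 0 < m.-1%:R :> C by rewrite ltr0n; lia.
have def_m : m%:R = m.-1%:R + 1 :> C by rewrite natr1; congr _%:R; lia.
have p_le t : 0 < t -> c * t <= p`_0 * (1 + S * t / m%:R) ^+ m.
  move=> t_gt0; apply: le_trans (le_p t t_gt0) _; rewrite def_p ler_pM2l //.
  have -> : S * t = \sum_(x <- [seq x * t | x <- b]) x by rewrite big_map mulr_suml.
  apply: prod_1D_le; rewrite ?size_map //; last by lia.
  rewrite all_map; apply: sub_all b_gt0 => x /= x_gt0.
  by rewrite mulr_ge0 // ltW.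
rewrite def_p1; have [S0|S_neq0] := eqVneq S 0.
  have [<-|c_neq0] := eqVneq 0 c; first by rewrite mul0r mulr_ge0 // ltW.
  have c_gt0 : 0 < c by rewrite lt_def eq_sym c_neq0.
  (* If [S = 0] then [p] is the constant [p.[0]]; this [t] would give [2 * p.[0] <= p.[0]]. *)
  have /p_le : 0 < 2 * p`_0 / c by rewrite divr_gt0 // mulr_gt0.
  rewrite S0 !mul0r addr0 expr1n mulr1 mulrC divfK ?(eq_sym c) //.
  by rewrite ger_pMl // (ler_nat _ 2 1).
have S_gt0 : 0 < S by rewrite lt_def S_neq0.
(* [t] minimizing [(1 + S t / m)^m / t]. *)
have /p_le : 0 < m%:R / (S * m.-1%:R) by rewrite divr_gt0 ?mulr_gt0 // ltr0n; lia.
have -> : 1 + S * (m%:R / (S * m.-1%:R)) / m%:R = m%:R / m.-1%:R.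
  by rewrite def_m; field; rewrite -def_m S_neq0 m0 gt_eqF.
rewrite -[m in _ ^+ m]prednK; last by lia.
rewrite exprS => le_c.
have G_gt0 : 0 < gurvits_const C m.
  by rewrite exprn_gt0 // divr_gt0 // ltr0n; lia.
have u_gt0 : 0 < S * m.-1%:R / m%:R * gurvits_const C m.
  by rewrite !mulr_gt0 // invr_gt0 ltr0n; lia.
move: le_c; rewrite -(ler_pM2l u_gt0).
have m1_neq0 : m.-1%:R != 0 :> C by rewrite gt_eqF.
have -> : S * m.-1%:R / m%:R * gurvits_const C m * (c * (m%:R / (S * m.-1%:R)))
   = c * gurvits_const C m.
  by field; rewrite S_neq0 m0 m1_neq0.
suff -> : S * m.-1%:R / m%:R * gurvits_const C m *
    (p`_0 * (m%:R / m.-1%:R * (m%:R / m.-1%:R) ^+ m.-1)) = p`_0 * S by [].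
have : gurvits_const C m * (m%:R / m.-1%:R) ^+ m.-1 = 1.
  rewrite /gurvits_const -exprMn; have -> : m.-1%:R / m%:R * (m%:R / m.-1%:R) = 1 :> C.
    by field; rewrite m0 m1_neq0.
  by rewrite expr1n.
move: (gurvits_const C m) (_ ^+ m.-1) => u v uv1.
transitivity (p`_0 * S * (u * v)); last by rewrite uv1 mulr1.
by field; rewrite ?m0 ?m1_neq0.
Qed.

Lemma gurvits_univariate1 (p : {poly C}) (c : C) :
  (size p <= 2)%N -> 0 <= p`_0 -> 0 <= p`_1 -> 0 <= c ->
  (forall t, 0 < t -> c * t <= p.[t]) -> c <= p`_1.
Proof.
move=> size_p p0_ge0 p1_ge0 c_ge0 le_p.
rewrite real_leNgt ?ger0_real //; apply/negP => lt_c.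
have /le_p : 0 < (p`_0 + 1) / (c - p`_1).
  by rewrite divr_gt0 ?subr_gt0 // ltr_wpDl.
rewrite (horner_coef_wide _ size_p) !big_ord_recl big_ord0 addr0 expr0 mulr1 expr1.
rewrite -lerBlDr -mulrBl mulrC divfK ?gerDl ?ler10 //.
by rewrite subr_eq0 gt_eqF.
Qed.

End Univariate.

Lemma card_notin_lt (n : nat) (J : {set 'I_n}) k : k \notin J -> (#|J| < n)%N.
Proof.
move=> kJ; rewrite -[n in (_ < n)%N]card_ord -cardsT proper_card //.
by rewrite properE subsetT; apply/subsetPn; exists k; rewrite ?inE.
Qed.

(** * Stability and the induction on the set of differentiated variables *)

Section Stable.
Variables (C : numClosedFieldType) (n : nat) (A : 'M[C]_n).
Hypothesis A_gt0 : forall i j, 0 < A i j.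
Implicit Types (J : {set 'I_n}) (x : 'I_n -> C).

(* Nonvanishing is also required on the boundary of the half-plane, as long as
   one variable is in the interior: for positive matrices this comes for free,
   and makes the induction step avoid limits. *)
Definition stable J := forall x,
  (forall j, j \notin J -> 0 <= 'Re (x j)) ->
  (exists2 j, j \notin J & 0 < 'Re (x j)) -> mixed A J x != 0.

Lemma stable_set0 : stable set0.
Proof.
move=> x x_ge0 [j0 _ x_gt0]; rewrite mixed_set0; apply/prodf_neq0 => i _.
have : 0 < 'Re (\sum_j A i j * x j).
  rewrite raddf_sum /= (bigD1 j0) //= ltr_pwDl //.
    by rewrite ReMl ?gtr0_real // mulr_gt0.
  apply: sumr_ge0 => j _; rewrite ReMl ?gtr0_real //.
  by rewrite mulr_ge0 ?x_ge0 ?inE // ltW.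
by apply: contraTneq => ->; rewrite raddf0 ltxx.
Qed.

Lemma mixed_poly_lead_neq0 J k x : stable J -> k \notin J ->
  (mixed_poly A J k x)`_(n - #|J|) != 0.
Proof.
move=> stJ kJ; rewrite lead_mixed_poly //; apply: stJ => [j _|].
  by case: eqP => _; rewrite ?Re1 ?Re0 ?raddf0 ?(Creal_ReP _ _) ?real1 ?ler01.
by exists k; rewrite // eqxx (Creal_ReP _ _) ?real1.
Qed.

Lemma size_mixed_poly_stable J k x : stable J -> k \notin J ->
  size (mixed_poly A J k x) = (n - #|J|).+1.
Proof.
move=> stJ kJ; apply/eqP; rewrite eqn_leq size_mixed_poly //= ltnNge.
apply: contra (mixed_poly_lead_neq0 x stJ kJ) => le_size.
by rewrite nth_default.
Qed.

(** A Gauss-Lucas argument: with the other variables fixed, all roots [r] of [p] have negative real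
    part, hence so do their inverses, and the logarithmic derivative of [p] at 0, the sum of the
    [- r^-1], has positive real part. *)
Lemma stableU1 J k : k \notin J -> stable J -> stable (k |: J).
Proof.
move=> kJ stJ x x_ge0 [j0 j0J x_gt0]; rewrite -coef1_mixed_poly //.
set p := mixed_poly A J k x.
have p_neq0 t : 0 <= 'Re t -> ~~ root p t.
  move=> t_ge0; rewrite rootE horner_mixed_poly; apply: stJ => [j jJ|].
    by case: eqP => // /eqP jk; apply: x_ge0; rewrite !inE negb_or jk.
  move: j0J; rewrite !inE negb_or => /andP[/negPf j0k j0J].
  by exists j0; rewrite // j0k.
have [s def_p] := closed_field_poly_normal p.
have lead_p : lead_coef p != 0.
  by rewrite lead_coef_eq0 -size_poly_eq0 size_mixed_poly_stable.
have s_lt0 r : r \in s -> 'Re r < 0.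
  move=> rs; rewrite real_ltNge ?Creal_Re //; apply/negP => /p_neq0.
  by rewrite def_p rootZ // root_prod_XsubC rs.
have s0 : 0 \notin s by apply/negP => /s_lt0; rewrite raddf0 ltxx.
rewrite def_p coefZ coef1_prod_XsubC // !mulf_neq0 //.
  by rewrite prodf_seq_neq0; apply/allP => r rs; rewrite oppr_eq0; apply: contraNneq s0 => <-.
(* Without a root the sum would be empty and its real part 0; the exact degree [n - #|J|] excludes
   this. *)
have size_s : (0 < size s)%N.
  have := size_mixed_poly_stable x stJ kJ; rewrite -/p def_p size_scale //.
  by rewrite size_prod_XsubC => -[->]; rewrite subn_gt0 (card_notin_lt kJ).
have Re_inv r : r \in s -> 0 < 'Re (- r^-1).
  move=> rs; rewrite raddfN /= oppr_gt0 ReV pmulr_llt0 ?s_lt0 //.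
  by rewrite invr_gt0 exprn_gt0 // normr_gt0; apply: contraNneq s0 => <-.
have : 0 < 'Re (\sum_(r <- s) - r^-1).
  case: s size_s Re_inv {def_p s_lt0 s0} => // r s _ Re_inv.
  rewrite raddf_sum big_cons /= ltr_pwDl ?Re_inv ?mem_head //.
  by rewrite big_seq sumr_ge0 // => z zs; rewrite ltW // Re_inv // inE zs orbT.
by apply: contraTneq => ->; rewrite raddf0 ltxx.
Qed.

(* If [r] is not a nonpositive real then [|r| + conj r] rotates both [r] and
   the positive reals into the open right half-plane. *)
Lemma rotate_gt0 (r : C) : ~~ (r <= 0) ->
  0 < 'Re (`|r| + r^*) /\ 0 < 'Re ((`|r| + r^*) * r).
Proof.
move=> r_pos; have r0 : r != 0 by apply: contraNneq r_pos => ->; rewrite lexx.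
have Re_gt0 : 0 < `|r| + 'Re r.
  have := leif_Re_Creal (- r); rewrite oppr_ge0 normrN raddfN /= => /lt_leif.
  by rewrite r_pos -subr_gt0 opprK.
rewrite mulrDl raddfD /= Re_conj (Creal_ReP _ (normr_real r)); split=> //.
rewrite [_^* * r]mulrC -normCK raddfD /= ReMl ?normr_real //.
rewrite (Creal_ReP (_ ^+ 2) _) ?realX ?normr_real // expr2 -mulrDr addrC.
by rewrite mulr_gt0 // normr_gt0.
Qed.

(** Otherwise a common rotation moves [r] and the positive values of the other variables into the
    open right half-plane; by homogeneity it only multiplies the value by a power of [c]. *)
Lemma root_mixed_poly_le0 J k x r : k \notin J -> stable J ->
  (forall j, 0 < x j) -> root (mixed_poly A J k x) r -> r <= 0.
Proof.
move=> kJ stJ x_gt0 root_r; apply: contraTT root_r => /rotate_gt0[c_gt0 cr_gt0].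
rewrite rootE horner_mixed_poly; set c := `|r| + r^* in c_gt0 cr_gt0.
have : mixed A J (fun j => c * (if j == k then r else x j)) != 0.
  have cx_gt0 j : 0 < 'Re (c * (if j == k then r else x j)).
    by case: eqP => // _; rewrite ReMr ?gtr0_real // mulr_gt0.
  by apply: stJ => [j _|]; [rewrite ltW | exists k].
by rewrite mixed_scale mulf_eq0 negb_or => /andP[].
Qed.

Lemma mixed_ge0 J x : (forall j, 0 <= x j) -> 0 <= mixed A J x.
Proof.
move=> x_ge0; apply: sumr_ge0 => f _; apply: prodr_ge0 => i _.
by rewrite mulr_ge0 ?(ltW (A_gt0 _ _)) //; case: ifP.
Qed.

Lemma mixed_capacity_step J k c : k \notin J -> stable J -> 0 <= c ->
  (forall x, (forall j, 0 < x j) -> c * \prod_(j in ~: J) x j <= mixed A J x) ->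
  forall x, (forall j, 0 < x j) ->
  c * gurvits_const C (n - #|J|) * \prod_(j in ~: (k |: J)) x j <= mixed A (k |: J) x.
Proof.
move=> kJ stJ c_ge0 le_c x x_gt0; rewrite -coef1_mixed_poly // mulrAC.
set p := mixed_poly A J k x; set d := c * _.
have d_ge0 : 0 <= d by rewrite mulr_ge0 ?prodr_ge0 // => j _; rewrite ltW.
have le_p t : 0 < t -> d * t <= p.[t].
  move=> t_gt0; rewrite horner_mixed_poly.
  apply: le_trans (le_c (fun j => if j == k then t else x j) _) => [|j]; last by case: ifP.
  rewrite (bigD1 k) ?inE //= eqxx le_eqVlt; apply/orP; left; apply/eqP.
  rewrite /d -mulrA; congr (_ * _); rewrite mulrC; congr (_ * _).
  apply: eq_big => [j|j]; first by rewrite !inE negb_or andbC.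
  by rewrite !inE negb_or => /andP[/negPf->].
have p0_ge0 : 0 <= p`_0.
  rewrite -horner_coef0 horner_mixed_poly mixed_ge0 // => j.
  by case: ifP => // _; rewrite ltW.
have p1_ge0 : 0 <= p`_1.
  by rewrite coef1_mixed_poly // mixed_ge0 // => j; rewrite ltW.
have J_lt : (0 < n - #|J|)%N.
  by rewrite subn_gt0 (card_notin_lt kJ).
have size_p := size_mixed_poly_stable x stJ kJ; rewrite -/p in size_p.
have [n1|m_gt1] := leqP (n - #|J|) 1.
  have m1 : (n - #|J| = 1)%N by lia.
  rewrite m1 /gurvits_const expr0 mulr1.
  by apply: gurvits_univariate1 => //; rewrite size_p m1.
(* A second free variable, at a positive value, makes stability apply at [t = 0]; thus 0 is not a
   root and the roots are strictly negative. *)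
have [j0 j0J] : exists j0, j0 \notin k |: J.
  apply/existsP; rewrite -negb_forall; apply/forallP => allJ.
  have : (n <= #|k |: J|)%N.
    by rewrite -[n in (n <= _)%N]card_ord; apply/subset_leq_card/subsetP.
  by rewrite cardsU1 kJ; lia.
have p0_neq0 : p`_0 != 0.
  rewrite -horner_coef0 horner_mixed_poly; apply: stJ => [j jJ|].
    by case: eqP => _; rewrite ?raddf0 // (Creal_ReP _ _) ?gtr0_real // ltW.
  move: j0J; rewrite !inE negb_or => /andP[/negPf j0k j0J].
  by exists j0; rewrite // j0k (Creal_ReP _ _) ?gtr0_real.
have [s def_p] := closed_field_poly_normal p.
have lead_p : lead_coef p != 0 by rewrite lead_coef_eq0 -size_poly_eq0 size_p.
have s_lt0 : all (< 0) s.
  apply/allP => r rs; have root_r : root p r.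
    by rewrite def_p rootZ // root_prod_XsubC.
  rewrite /= lt_neqAle (root_mixed_poly_le0 kJ stJ x_gt0 root_r) andbT.
  by apply: contraNneq p0_neq0 => r0; rewrite -horner_coef0 -rootE -r0.
have size_s : size s = (n - #|J|)%N.
  by apply/succn_inj; rewrite -size_p def_p size_scale // size_prod_XsubC.
rewrite def_p; apply: gurvits_univariate => //; rewrite -?def_p //.
- by rewrite size_s.
- by rewrite lt_def p0_neq0.
Qed.

End Stable.

Section Permanent.
Variables (C : numClosedFieldType) (n : nat) (A : 'M[C]_n).
Hypothesis A_gt0 : forall i j, 0 < A i j.
Hypothesis capA : forall x : 'I_n -> C, (forall j, 0 < x j) ->
  \prod_j x j <= \prod_i \sum_j A i j * x j.

Lemma gurvits_const_ge0 (F : numFieldType) m : 0 <= gurvits_const F m.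
Proof. by rewrite exprn_ge0 // divr_ge0. Qed.

Lemma mixed_capacity J : stable A J /\ forall x, (forall j, 0 < x j) ->
  \prod_(i < #|J|) gurvits_const C (n - i) * \prod_(j in ~: J) x j <= mixed A J x.
Proof.
have [m] := ubnP #|J|; elim: m => // m IHm in J *; rewrite ltnS => leJm.
have [->|[k kJ]] := set_0Vmem J.
  split=> [|x x_gt0]; first exact: stable_set0.
  rewrite cards0 big_ord0 mul1r mixed_set0; apply: le_trans (capA x_gt0).
  by rewrite setC0 (eq_bigl predT) // => j; rewrite inE.
have kJ' : k \notin J :\ k by rewrite !inE eqxx.
rewrite -(setD1K kJ); have [|stJ le_J] := IHm (J :\ k).
  by move: leJm; rewrite (cardsD1 k) kJ.
split=> [|x x_gt0]; first exact: stableU1.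
rewrite cardsU1 kJ' big_ord_recr /=.
by apply: mixed_capacity_step => //; apply: prodr_ge0 => i _; apply: gurvits_const_ge0.
Qed.

Lemma per_ge_gurvits : \prod_(i < n) gurvits_const C (n - i) <= per A.
Proof.
have [_ /(_ (fun=> 1))] := mixed_capacity setT.
rewrite mixed_setT cardsT card_ord [\prod_(j in ~: _) _]big1 // mulr1.
by apply=> _; exact: ltr01.
Qed.

End Permanent.

(** The factor for [m] is [m * (m - 1)^(m - 1) / m^m], so the product telescopes, with [0^0 = 1] at
    [m = 1]. *)
Lemma prod_gurvits_const (F : numFieldType) n :
  \prod_(i < n) gurvits_const F (n - i) = n`!%:R / n%:R ^+ n.
Proof.
elim: n => [|n IHn]; first by rewrite big_ord0 expr0 divr1.
rewrite big_ord_recl subn0 (eq_bigr (fun i : 'I_n => gurvits_const F (n - i))) //.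
rewrite IHn /gurvits_const /= factS natrM exprS expr_div_n.
case: n {IHn} => [|n]; first by rewrite !expr0; field.
by field; rewrite -(natrD _ 2 n) !expf_neq0 ?pnatr_eq0.
Qed.

Lemma perZ (S : comPzSemiRingType) (n : nat) (a : S) (A : 'M[S]_n) :
  per (a *: A) = a ^+ n * per A.
Proof.
rewrite /per big_distrr /=; apply: eq_bigr => s _.
under eq_bigr do rewrite mxE.
by rewrite big_split /= prodr_const card_ord.
Qed.

(** * From capacity to doubly stochastic matrices *)

Section VanDerWaerden.
Variables (R : realType) (n : nat).

(** Weighted AM-GM in each row, with the entries of the row as weights; multiplying over the rows,
    each [x j] gets the exponent [\sum_i A i j = 1]. *)
Lemma capacity_doubly_stochastic (A : 'M[R]_n) (x : 'I_n -> R) :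
  (forall i j, 0 < A i j) -> (forall i, \sum_j A i j = 1) ->
  (forall j, \sum_i A i j = 1) -> (forall j, 0 < x j) ->
  \prod_j x j <= \prod_i \sum_j A i j * x j.
Proof.
move=> A_gt0 rowA colA x_gt0; pose m i := \sum_j A i j * x j.
have m_gt0 i : 0 < m i.
  rewrite /m (bigD1 i) //= ltr_pwDl //; first exact: mulr_gt0.
  by apply: sumr_ge0 => j _; rewrite mulr_ge0 // ltW.
have le_m i : \sum_j A i j * ln (x j) <= ln (m i).
  rewrite -[ln (m i)]mul1r -(rowA i) mulr_suml -subr_ge0 -sumrB.
  (* Jensen's inequality for [ln], from its tangent at the mean [m i]; the tangent terms cancel. *)
  apply: le_trans (_ : 0 <= \sum_j A i j * (1 - x j / m i)) _.
    rewrite le_eqVlt; apply/orP; left; apply/eqP/esym.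
    under eq_bigr do rewrite mulrBr mulr1 mulrA.
    by rewrite sumrB rowA -mulr_suml -/(m i) divff ?subrr // gt_eqF.
  apply: ler_sum => j _; rewrite -mulrBr ler_pM2l //.
  rewrite -ln_div ?posrE // -[x j / m i]invf_div.
  have u_gt0 : 0 < m i / x j by rewrite divr_gt0.
  have := expR_ge1Dx (- ln (m i / x j)).
  by rewrite expRN lnK ?posrE // => le1; rewrite lerBlDr addrC -lerBlDr.
have def_x j : x j = expR (ln (x j)) by rewrite lnK ?posrE.
have -> : \prod_j x j = \prod_i expR (\sum_j A i j * ln (x j)).
  rewrite -expR_sum exchange_big expR_sum; apply: eq_bigr => j _ /=.
  by rewrite -mulr_suml colA mul1r -def_x.
by apply: ler_prod => i _; rewrite expR_ge0 -[leRHS](lnK (m_gt0 i)) ler_expR le_m.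
Qed.

Lemma van_der_waerden_pos (A : 'M[R]_n) :
  (forall i j, 0 < A i j) -> (forall i, \sum_j A i j = 1) ->
  (forall j, \sum_i A i j = 1) -> n`!%:R / n%:R ^+ n <= per A.
Proof.
move=> A_gt0 rowA colA; pose phi : {rmorphism R -> R[i]} := real_complex R.
have := @per_ge_gurvits _ n (map_mx phi A).
rewrite prod_gurvits_const.
have -> : per (map_mx phi A) = phi (per A).
  rewrite /per rmorph_sum; apply: eq_bigr => s _; rewrite rmorph_prod.
  by apply: eq_bigr => i _; rewrite mxE.
have -> : n`!%:R / n%:R ^+ n = phi (n`!%:R / n%:R ^+ n).
  by rewrite rmorphM fmorphV rmorphXn !rmorph_nat.
rewrite lecR; apply => [i j|x x_gt0]; first by rewrite mxE ltcR.
(* In [R[i]], [0 < x j] forces [x j] to be real. *)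
pose y j := complex.Re (x j).
have def_x j : x j = phi (y j) by apply/esym/RRe_real/gtr0_real.
have y_gt0 j : 0 < y j by rewrite -ltcR -[(y j)%:C%C]/(phi (y j)) -def_x.
have -> : \prod_j x j = phi (\prod_j y j).
  by rewrite rmorph_prod; apply: eq_bigr.
have -> : \prod_i \sum_j map_mx phi A i j * x j = phi (\prod_i \sum_j A i j * y j).
  rewrite rmorph_prod; apply: eq_bigr => i _; rewrite rmorph_sum.
  by apply: eq_bigr => j _; rewrite mxE def_x rmorphM.
by rewrite lecR; apply: capacity_doubly_stochastic.
Qed.

Lemma ge_horner0 (p : {poly R}) c :
  (forall e, 0 < e -> c <= p.[e]) -> c <= p.[0].
Proof.
move=> le_p; apply/ler_addgt0Pr => d d_gt0.
have [e e_gt0 cont_e] := poly_cont 0 p d_gt0.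
have e2_gt0 : 0 < e / 2 by rewrite divr_gt0.
apply: le_trans (le_p _ e2_gt0) _; rewrite -lerBlDl.
apply: le_trans (ler_norm _) _; apply/ltW/cont_e.
by rewrite subr0 gtr0_norm // ltr_pdivrMr // ltr_pMr // ltr1n.
Qed.

(** Adding [e] to every entry and dividing by [1 + n e] yields a positive doubly stochastic matrix.
    Undoing the division does not decrease the permanent, and [per (A + const_mx e)] is a polynomial
    in [e], so [e] can tend to 0. *)
Theorem van_der_waerden (A : 'M[R]_n) :
  (forall i j, 0 <= A i j) -> (forall i, \sum_j A i j = 1) ->
  (forall j, \sum_i A i j = 1) -> n`!%:R / n%:R ^+ n <= per A.
Proof.
move=> A_ge0 rowA colA.
pose p : {poly R} := \sum_(s : 'S_n) \prod_i ((A i (s i))%:P + 'X).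
have def_p e : p.[e] = per (A + const_mx e).
  rewrite horner_sum; apply: eq_bigr => s _; rewrite horner_prod.
  by apply: eq_bigr => i _; rewrite hornerD hornerC hornerX !mxE.
have -> : per A = p.[0].
  by rewrite def_p; congr per; apply/matrixP => i j; rewrite !mxE addr0.
apply: ge_horner0 => e e_gt0; rewrite def_p.
have u_gt0 : 0 < 1 + n%:R * e by rewrite ltr_wpDr // mulr_ge0 // ltW.
have sum_e (F : 'I_n -> R) : \sum_j F j = 1 ->
    \sum_j (1 + n%:R * e)^-1 * (F j + e) = 1.
  move=> sumF; rewrite -mulr_sumr big_split /= sumF sumr_const card_ord.
  by rewrite -[e *+ n]mulr_natl mulVf // gt_eqF.
have := @van_der_waerden_pos ((1 + n%:R * e)^-1 *: (A + const_mx e)) _ _ _.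
rewrite perZ exprVn.
move=> le_per; apply: le_trans (le_per _ _ _) _.
- by move=> i j; rewrite !mxE mulr_gt0 ?invr_gt0 // ltr_wpDl.
- by move=> i; under eq_bigr do rewrite !mxE; apply: sum_e.
- by move=> j; under eq_bigr do rewrite !mxE; apply: sum_e.
rewrite ler_piMl //; last first.
  by rewrite invf_le1 ?exprn_gt0 // exprn_ege1 // lerDl mulr_ge0 // ltW.
apply: sumr_ge0 => s _; apply: prodr_ge0 => i _.
by rewrite !mxE addr_ge0 // ltW.
Qed.

End VanDerWaerden.

(** * Growth of the ratio of Mtilde to the permanent *)

Section Asymptotics.
Variable R : realType.
Local Notation g := (@g R).
Local Notation e := (@expR R 1).

(** With [x = ln y] this is [x <= sinh x]. *)
Lemma ln_le_half_diff (y : R) : 1 <= y -> ln y <= (y - y^-1) / 2.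
Proof.
move=> y_ge1; have y_gt0 : 0 < y by apply: lt_le_trans y_ge1.
pose f (x : R) : R := expR x - expR (- x) - 2 * x.
pose df (x : R) : R := expR x + expR (- x) - 2.
have f_df (x : R) : is_derive x 1 f (df x).
  by apply: is_derive_eq; rewrite /df /GRing.scale /=; ring.
have : f 0 <= f (ln y).
  apply: (nneg_derive_le (ln_ge0 y_ge1) f_df) => x _.
  by have := expR_ge1Dx x; have := expR_ge1Dx (- x); rewrite /df; lra.
by rewrite /f oppr0 expRN lnK ?posrE //; lra.
Qed.

Lemma ln_succ_ge (a : nat) : (0 < a)%N ->
  ln a%:R + a.+1%:R^-1 <= ln a.+1%:R :> R.
Proof.
move=> a_gt0; have a0 : 0 < a%:R :> R by rewrite ltr0n.
have : 0 < a.+1%:R :> R by rewrite ltr0n.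
have : 1 < a.+1%:R :> R by rewrite ltr1n.
rewrite -natr1; set b := a%:R + 1 => b1 b0.
have : ln (1 + - b^-1) <= - b^-1 by apply: le_ln1Dx; rewrite ltrN2 invf_lt1.
have -> : 1 + - b^-1 = a%:R / b by rewrite /b; field; rewrite gt_eqF.
by rewrite ln_div ?posrE //; lra.
Qed.

Lemma stirling_lower (n : nat) : (0 < n)%N ->
  (n%:R + 1 / 2) * ln n%:R - n%:R <= ln n`!%:R :> R.
Proof.
move=> n_gt0.
(* The extra term gives equality at [n = 1], and its decrease from [a] to [a + 1] is exactly the
   error [1 / (4 a (a + 1))] of the induction step. *)
suff : (n%:R + 1 / 2) * ln n%:R - n%:R + (3 + n%:R^-1) / 4 <= ln n`!%:R :> R.
  by have : 0 <= n%:R^-1 :> R by []; lra.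
case: n n_gt0 => // n _; elim: n => [|n IHn].
  by rewrite factS fact0 muln1 invr1 ln1; lra.
rewrite factS natrM lnM ?posrE ?ltr0n ?fact_gt0 //.
set a : R := n.+1%:R in IHn *; have a_gt0 : 0 < a by rewrite ltr0n.
have -> : n.+2%:R = a + 1 :> R by rewrite natr1.
have a1_gt0 : 0 < a + 1 by lra.
have y_ge1 : 1 <= (a + 1) / a by rewrite ler_pdivlMr // mul1r; lra.
have := ln_le_half_diff y_ge1; rewrite ln_div ?posrE // => le_ln.
have : (a + 1 / 2) * (ln (a + 1) - ln a) <= 1 + (a^-1 - (a + 1)^-1) / 4.
  apply: le_trans (ler_wpM2l _ le_ln) _; first lra.
  by rewrite le_eqVlt; apply/orP; left; apply/eqP; field; rewrite !gt_eqF.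
move: IHn; clearbody a; move: (ln _) (ln _) (ln _) (_^-1) => *; lra.
Qed.

Lemma g_le (a : nat) : (0 < a)%N -> g a <= a%:R + ln a%:R / 2 + e.
Proof.
move=> a_gt0.
(* Equality at [a = 1]. From [g a >= a + 1], the term [1 / (2 g a)] is at most half the increment of
   [ln], and [0.6 / g a ^+ 2] at most that of [- 0.6 / a]. *)
suff : g a <= a%:R + ln a%:R / 2 + e - 4 / 10 - (6 / 10) / a%:R.
  have : 0 <= (6 / 10) / a%:R :> R by rewrite divr_ge0.
  lra.
case: a a_gt0 => // a _; elim: a => [|a IHa]; first by rewrite ln1 /=; lra.
rewrite gS //.
set b : R := a.+1%:R in IHa *; have b_gt0 : 0 < b by rewrite ltr0n.
have g_ge := g_ge R (isT : (0 < a.+1)%N); have g_gt := g_gt0 R (isT : (0 < a.+1)%N).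
have := ln_succ_ge (isT : (0 < a.+1)%N).
have def_b : a.+2%:R = b + 1 :> R by rewrite natr1.
rewrite def_b in g_ge * => le_ln; rewrite -/b in le_ln.
have le1 : 1 / (2 * g a.+1) <= (b + 1)^-1 / 2.
  rewrite -[_ / 2]mul1r -invfM [2 * _]mulrC ler_pM2l // lef_pV2 ?posrE ?mulr_gt0 //; lra.
have le2 : 6 / 10 / g a.+1 ^+ 2 <= 6 / 10 * (b^-1 - (b + 1)^-1).
  have -> : b^-1 - (b + 1)^-1 = (b * (b + 1))^-1.
    by field; rewrite gt_eqF // gt_eqF //; lra.
  rewrite ler_pM2l; last lra.
  rewrite lef_pV2 ?posrE ?exprn_gt0 ?mulr_gt0 //; [nra | lra].
move: IHa le_ln le1 le2; clearbody b.
move: (1 / (2 * _)) (6 / 10 / _ ^+ 2) (b + 1)^-1 b^-1 (ln b) (ln (b + 1)) e => *; lra.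
Qed.

Lemma growth_bound (gamma : R) (n d : nat) : (0 < n)%N -> 0 < gamma -> gamma <= 1 ->
  d%:R = gamma * n%:R ->
  (g d / e) ^+ n <= expR (e / gamma) * n%:R `^ ((1 / 2) / gamma - 1 / 2)
    * (d%:R ^+ n * (n`!%:R / n%:R ^+ n)).
Proof.
move=> n_gt0 gamma_gt0 gamma_le1 def_d.
have nR_gt0 : 0 < n%:R :> R by rewrite ltr0n.
have dR_gt0 : 0 < d%:R :> R by rewrite def_d mulr_gt0.
have d_gt0 : (0 < d)%N by rewrite -(ltr0n R).
have g_gt := g_gt0 R d_gt0.
have f_gt0 : 0 < n`!%:R :> R by rewrite ltr0n fact_gt0.
have e_gt0 := expR_gt0 (1 : R).
set u := (1 / 2) / gamma - 1 / 2; set F : R := n`!%:R in f_gt0 *.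
have q_gt0 : 0 < g d / e by rewrite divr_gt0.
have dn_gt0 : 0 < d%:R ^+ n :> R by rewrite exprn_gt0.
have nn_gt0 : 0 < n%:R ^+ n :> R by rewrite exprn_gt0.
have Fn_gt0 : 0 < F / n%:R ^+ n by rewrite divr_gt0.
have nu_gt0 : 0 < n%:R `^ u by rewrite powR_gt0.
have lnL : ln ((g d / e) ^+ n) = n%:R * (ln (g d) - 1).
  by rewrite lnXn // ln_div ?posrE // expRK mulr_natl.
have lnR : ln (expR (e / gamma) * n%:R `^ u * (d%:R ^+ n * (F / n%:R ^+ n))) =
    e / gamma + u * ln n%:R + (n%:R * ln d%:R + (ln F - n%:R * ln n%:R)).
  have Eu_gt0 : 0 < expR (e / gamma) * n%:R `^ u by rewrite mulr_gt0 ?expR_gt0.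
  have dF_gt0 : 0 < d%:R ^+ n * (F / n%:R ^+ n) by rewrite mulr_gt0.
  rewrite lnM ?posrE // lnM ?posrE ?expR_gt0 // expRK ln_powR.
  by rewrite lnM ?posrE // ln_div ?posrE // !lnXn // !mulr_natl.
rewrite -ler_ln ?posrE ?exprn_gt0 //; last first.
  by rewrite (mulr_gt0 (mulr_gt0 (expR_gt0 _) nu_gt0)) // mulr_gt0.
rewrite lnL lnR /u /F.
have le_g : ln (g d) <= ln d%:R + (ln d%:R / 2 + e) / d%:R.
  rewrite -lerBlDl -ln_div ?posrE //.
  apply: le_trans (_ : g d / d%:R - 1 <= _).
    rewrite -[X in ln X](subrK 1) [X in ln X]addrC; apply: le_ln1Dx.
    have : 0 < g d / d%:R by rewrite divr_gt0.
    lra.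
  have -> : g d / d%:R - 1 = (g d - d%:R) / d%:R by field; rewrite gt_eqF.
  by rewrite ler_pM2r ?invr_gt0 //; have := g_le d_gt0; lra.
have le_d : ln d%:R <= ln n%:R :> R.
  by rewrite ler_ln ?posrE // def_d ger_pMl.
have := stirling_lower n_gt0.
have : n%:R * ln (g d) <= n%:R * ln d%:R + (ln n%:R / 2 + e) / gamma.
  apply: le_trans (ler_wpM2l (ltW nR_gt0) le_g) _; rewrite mulrDr lerD2l.
  have -> : n%:R * ((ln d%:R / 2 + e) / d%:R) = (ln d%:R / 2 + e) / gamma.
    by rewrite def_d; field; rewrite !gt_eqF.
  by rewrite ler_pM2r ?invr_gt0 //; lra.
have -> : 1 / 2 / gamma = gamma^-1 / 2 by field; rewrite gt_eqF.
rewrite -/F; clearbody F; move: (ln _) (ln _) (ln _) e (n%:R : R) gamma^-1 => *.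
lra.
Qed.

End Asymptotics.

(** * The estimator *)

Section Estimator.
Local Open Scope comp_scope.
Variable R : realType.
Local Notation g := (@g R).
Local Notation e := (@expR R 1).

Lemma per_regular_ge (n d : nat) (A : 'M[bool]_n) : (0 < d)%N ->
  (forall i, row_sum A i = d) -> (forall j, col_sum A j = d) ->
  d%:R ^+ n * (n`!%:R / n%:R ^+ n) <= per (zero_one_mx R A).
Proof.
move=> d_gt0 rowA colA; have dR_gt0 : 0 < d%:R :> R by rewrite ltr0n.
have : n`!%:R / n%:R ^+ n <= per (d%:R^-1 *: zero_one_mx R A).
  apply: van_der_waerden => [i j|i|j]; first by rewrite !mxE mulr_ge0 // invr_ge0 ltW.
    under eq_bigr do rewrite !mxE.
    by rewrite -mulr_sumr -natr_sum -/(row_sum A i) rowA mulVf // gt_eqF.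
  under eq_bigr do rewrite !mxE.
  by rewrite -mulr_sumr -natr_sum -/(col_sum A j) colA mulVf // gt_eqF.
by rewrite perZ exprVn ler_pdivlMl ?exprn_gt0.
Qed.

(** As the permanent is [Mtilde R A * p], scaling by [Mtilde R A / t] turns the interval around the
    mean [p * t] of the count into the required one. *)
Lemma prob_estimator_ge (n t : nat) (A : 'M[bool]_n) (sigma : R) :
  0 < sigma -> sigma < 1 -> (0 < t)%N -> (forall i, (0 < row_sum A i)%N) ->
  1 - 2 * expR (- (sigma ^+ 2 * prob (pass R A) fst * t%:R / 16)) <=
  prob (estimator R A t) (approximates sigma (per (zero_one_mx R A))).
Proof.
move=> sigma_gt0 sigma_lt1 t_gt0 rA; set p := prob _ _.
have M_gt0 := Mtilde_gt0 R rA; have tR_gt0 : 0 < t%:R :> R by rewrite ltr0n.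
have := chernoff_count fst (well_posed_pass R A) t sigma_gt0 sigma_lt1.
rewrite -/p => /le_trans; apply.
rewrite /prob /estimator expect_bind /=.
have -> : (fun (_ N : nat) => let* '(accept, _) := pass R A in Ret (N + accept)%N) =
    (fun (_ N : nat) => let* x := pass R A in Ret (N + x.1)%N).
  by apply/funext => i; apply/funext => N; congr bind; apply/funext; case.
rewrite le_eqVlt; apply/orP; left; apply/eqP.
apply: eq_expect => N /=; congr (nat_of_bool _)%:R; rewrite /approximates.
rewrite -Mtilde_prob_accept -/p.
have -> : (1 + sigma)^-1 * (Mtilde R A * p) =
    Mtilde R A / t%:R * ((1 + sigma)^-1 * (p * t%:R)) by field; rewrite gt_eqF //; lra.
have -> : (1 + sigma) * (Mtilde R A * p) =
    Mtilde R A / t%:R * ((1 + sigma) * (p * t%:R)) by field; rewrite gt_eqF.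
by rewrite -[Mtilde R A * N%:R / _]mulrAC !ler_pM2l // divr_gt0.
Qed.

(** Upper bound for [Mtilde A / per A]; its inverse bounds the acceptance probability from below. *)
Definition growth (gamma : R) (n : nat) : R :=
  expR (e / gamma) * n%:R `^ ((1 / 2) / gamma - 1 / 2).

Lemma prob_accept_ge (gamma : R) (n : nat) (A : 'M[bool]_n) : 0 < gamma -> gamma <= 1 ->
  (0 < n)%N -> (forall i, (row_sum A i)%:R = gamma * n%:R) ->
  (forall j, (col_sum A j)%:R = gamma * n%:R) ->
  (forall i, (0 < row_sum A i)%N) /\ 1 <= growth gamma n * prob (pass R A) fst.
Proof.
move=> gamma_gt0 gamma_le1 n_gt0 rowA colA.
pose d := row_sum A (Ordinal n_gt0); have def_d := rowA (Ordinal n_gt0).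
have nR_gt0 : 0 < n%:R :> R by rewrite ltr0n.
have d_gt0 : (0 < d)%N by rewrite -(ltr0n R) def_d mulr_gt0.
have rowd i : row_sum A i = d by apply/eqP; rewrite -(eqr_nat R) rowA def_d.
have cold j : col_sum A j = d by apply/eqP; rewrite -(eqr_nat R) colA def_d.
have rA i : (0 < row_sum A i)%N by rewrite rowd.
split=> //; have M_gt0 := Mtilde_gt0 R rA.
rewrite -(ler_pM2l M_gt0) mulr1 mulrCA Mtilde_prob_accept.
have -> : Mtilde R A = (g d / e) ^+ n.
  by rewrite /Mtilde; under eq_bigr do rewrite rowd; rewrite prodr_const card_ord.
apply: le_trans (growth_bound n_gt0 gamma_gt0 gamma_le1 def_d) _.
rewrite ler_wpM2l ?mulr_ge0 ?expR_ge0 ?powR_ge0 //.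
exact: per_regular_ge.
Qed.

(** Solves [2 exp (- sigma^2 p t / 16) = delta] for [t] with [p] replaced by the inverse of
    [growth]. The minimum keeps the logarithm positive when [delta] is large. *)
Definition passes_real (gamma : R) (n : nat) (sigma delta : R) : R :=
  16 * ln (2 / Num.min delta (1 / 2)) / sigma ^+ 2 * growth gamma n.

Definition passes (gamma : R) (n : nat) (sigma delta : R) : nat :=
  (Num.truncn (passes_real gamma n sigma delta)).+1.

Lemma passes_real_ge0 gamma n sigma delta : 0 < delta ->
  0 <= passes_real gamma n sigma delta.
Proof.
move=> delta_gt0; rewrite /passes_real.
have m_gt0 : 0 < Num.min delta (1 / 2) by rewrite lt_min delta_gt0 /=; lra.
have m_le : Num.min delta (1 / 2) <= 1 / 2 by rewrite ge_min lexx orbT.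
rewrite mulr_ge0 ?mulr_ge0 ?expR_ge0 ?powR_ge0 ?invr_ge0 ?sqr_ge0 //.
by apply: ln_ge0; rewrite ler_pdivlMr //; lra.
Qed.

Lemma failure_le gamma n sigma delta (p : R) : 0 < delta -> 0 < sigma -> 0 <= p ->
  1 <= growth gamma n * p ->
  2 * expR (- (sigma ^+ 2 * p * (passes gamma n sigma delta)%:R / 16)) <= delta.
Proof.
move=> delta_gt0 sigma_gt0 p_ge0 le_gp; set m := Num.min delta (1 / 2).
have m_gt0 : 0 < m by rewrite lt_min delta_gt0 /=; lra.
have m_le : m <= delta by rewrite ge_min lexx.
have m_le2 : m <= 1 / 2 by rewrite ge_min lexx orbT.
apply: le_trans m_le; rewrite -ler_pdivlMl // expRN.
have L_ge0 : 0 <= ln (2 / m) by apply: ln_ge0; rewrite ler_pdivlMr //; lra.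
rewrite [leRHS]mulrC -[leRHS]invf_div lef_pV2 ?posrE ?expR_gt0 ?divr_gt0 //.
rewrite -[leLHS]lnK ?posrE ?divr_gt0 // ler_expR.
apply: le_trans (_ : sigma ^+ 2 * p * passes_real gamma n sigma delta / 16 <= _).
  have -> : sigma ^+ 2 * p * passes_real gamma n sigma delta / 16 =
     ln (2 / m) * (growth gamma n * p).
    by rewrite /passes_real -/m; field; rewrite gt_eqF.
  by rewrite ler_peMr.
rewrite ler_pM2r; last by rewrite invr_gt0; lra.
by rewrite ler_wpM2l ?mulr_ge0 ?sqr_ge0 // ltW // truncnS_gt.
Qed.

(** [delta <= 1 / 2] gives [ln (2 / delta) <= 2 ln (1 / delta)], whence 32 instead of 16. It also
    bounds [K * S] below by [ln 2], so [(ln 2)^-1] pays for rounding up. *)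
Lemma passes_le (gamma : R) n sigma delta : 0 < gamma -> gamma <= 1 -> (0 < n)%N ->
  0 < sigma -> sigma < 1 -> 0 < delta -> delta <= 1 / 2 ->
  (passes gamma n sigma delta)%:R * n%:R ^+ 2 <=
  (32 * expR (e / gamma) + (ln 2)^-1) *
    (n%:R `^ (3 / 2 + (1 / 2) / gamma) * (ln (1 / delta) / sigma ^+ 2)).
Proof.
move=> gamma_gt0 gamma_le1 n_gt0 sigma_gt0 sigma_lt1 delta_gt0 delta_le.
have nR_ge1 : 1 <= n%:R :> R by rewrite ler1n.
have nR_gt0 : 0 < n%:R :> R by rewrite ltr0n.
set u := 1 / 2 / gamma - 1 / 2.
have u_ge0 : 0 <= u.
  by rewrite subr_ge0 ler_pdivlMr //; lra.
have -> : n%:R `^ (3 / 2 + (1 / 2) / gamma) = n%:R `^ u * n%:R ^+ 2.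
  rewrite -powR_mulrn ?ltW // -powRD; last by rewrite lt0r_neq0 // implybT.
  by congr (_ `^ _); rewrite /u; lra.
rewrite [n%:R `^ u * _ * _]mulrAC [leRHS]mulrA ler_pM2r ?exprn_gt0 //.
set K := n%:R `^ u; set S := _ / sigma ^+ 2.
have K_ge1 : 1 <= K by rewrite -(powRr0 n%:R) ler_powR.
have L2_gt0 : 0 < ln 2 :> R by rewrite ln_gt0 // ltr1n.
have ln_ge : ln 2 <= ln (1 / delta).
  by rewrite ler_ln ?posrE ?divr_gt0 // ler_pdivlMr //; lra.
have S_ge : ln 2 <= S.
  apply: (le_trans ln_ge); rewrite ler_peMr //.
    exact: le_trans (ltW L2_gt0) ln_ge.
  by rewrite invf_ge1 ?exprn_gt0 // exprn_ile1 // ltW.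
have ln2d : ln (2 / delta) <= 2 * ln (1 / delta).
  have -> : 2 / delta = 2 * (1 / delta) by ring.
  by rewrite lnM ?posrE ?divr_gt0 //; lra.
have le_t : (passes gamma n sigma delta)%:R <= 32 * expR (e / gamma) * (K * S) + 1.
  rewrite /passes -natr1 lerD2r.
  apply: (@le_trans _ _ (passes_real gamma n sigma delta)).
    by rewrite truncn_le passes_real_ge0.
  rewrite /passes_real /growth -/u -/K min_l // /S.
  set E := expR _; set v := sigma ^+ 2.
  have -> : 16 * ln (2 / delta) / v * (E * K) = 16 * E * K / v * ln (2 / delta) by ring.
  have -> : 32 * E * (K * (ln (1 / delta) / v)) = 16 * E * K / v * (2 * ln (1 / delta)).
    by ring.
  rewrite ler_wpM2l // !mulr_ge0 ?expR_ge0 ?powR_ge0 ?invr_ge0 ?sqr_ge0 //.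
have KS : 1 <= (ln 2)^-1 * (K * S).
  rewrite mulrC ler_pdivlMr // mul1r; apply: (le_trans S_ge).
  by rewrite ler_peMl // (le_trans (ltW L2_gt0) S_ge).
apply: le_trans le_t _; rewrite -mulrA mulrDl mulrA; lra.
Qed.

End Estimator.

Theorem theorem3 (R : realType) (gamma : R)
    (gamma_gt0 : 0 < gamma) (gamma_le1 : gamma <= 1) :
  exists (t : nat -> R -> R -> nat) (C : R),
  forall (n : nat) (sigma delta : R) (A : 'M[bool]_n),
    (0 < n)%N -> 0 < sigma -> sigma < 1 -> 0 < delta ->
    (forall i : 'I_n, (row_sum A i)%:R = gamma * n%:R) ->
    (forall j : 'I_n, (col_sum A j)%:R = gamma * n%:R) ->
    let passes := t n sigma delta in
    let Z := estimator R A passes in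
    let program := estimator_prog R A passes in
    [/\ (0 < passes)%N,
        well_posed Z /\ 1 - delta <= prob Z (approximates sigma (per (zero_one_mx R A))),
        well_posed program /\ same_law program Z
      & delta <= 1 / 2 ->
        expected_time program
          <= C * (n%:R `^ (3 / 2 + (1 / 2) / gamma) * (ln (1 / delta) / sigma ^+ 2))].
Proof.
exists (passes gamma), (100 * (32 * expR (expR 1 / gamma) + (ln 2)^-1)).
move=> n sigma delta A n_gt0 sigma_gt0 sigma_lt1 delta_gt0 rowA colA t Z program.
have [rA le_p] := prob_accept_ge gamma_gt0 gamma_le1 n_gt0 rowA colA.
have wZ : well_posed Z by apply: well_posed_estimator.
have sim_Z : simulates eq program Z (t * n * n * 100) by apply: simulates_estimator.
split=> //.
- split=> //; apply: le_trans (prob_estimator_ge sigma_gt0 sigma_lt1 _ rA) => //.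
  by rewrite lerB // failure_le // prob_ge0 //; apply: well_posed_pass.
- split; first exact: simulates_well_posed sim_Z wZ.
  by move=> h; apply: (simulates_expect sim_Z) => x y ->.
move=> delta_le; apply: le_trans (simulates_expected_time sim_Z wZ) _.
rewrite natrM [leLHS]mulrC -[leRHS]mulrA ler_pM2l ?ltr0n //.
have := passes_le gamma_gt0 gamma_le1 n_gt0 sigma_gt0 sigma_lt1 delta_gt0 delta_le.
by rewrite -/t !natrM expr2 mulrA.
Qed.
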